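(* Let $y\in[2,x]$ and let $A$ be a random variable taking values in $[1,x]\cap\mathbb{N}$. Let $\mathcal{P}$ be a subset of the primes up to $y$. Let $g\colon\mathbb{N}\to[0,1]$ be a multiplicative function with $g(d)=0$ for all $d\notin\langle\mathcal{P}\rangle$. Suppose that $g(p^{k+1})\le g(p^k)$ for all $p\in\mathcal{P}$ and all integers $k\ge 0$, and that $\lim_{k\to\infty}g(p^k)=0$ for all $p\in\mathcal{P}$. Suppose that there exist $\kappa\ge 0$ and $B>0$ such that the following holds: for every $d\in\langle\mathcal{P}\rangle$ such that $g(p^{\nu_p(d)+1})<g(p^{\nu_p(d)})$ for all $p\in\mathcal{P}$, we have $$\prod_{a\le p\le b}\left(1-\frac{g(pd)}{g(d)}\right)^{-1}\le\left(\frac{\log b}{\log a}\right)^{\kappa}\exp\left(\frac{B}{\log a}\right)$$ for all $2\le a\le b\le y$ (the product being over primes $p$). Let $(G_p)_{p\in\mathcal{P}}$ be independent random variables taking values in $\mathbb{N}_{\ge 0}$ with $\mathbb{P}(G_p=k)=g(p^k)-g(p^{k+1})$ for all integers $k\ge 0$. Then, for any parameters $S>T>0$ with $S/T\ge y$, we have $$\mathrm{d}_{\mathrm{TV}}\big((\nu_p(A))_{p\in\mathcal{P}},(G_p)_{p\in\mathcal{P}}\big)\ll_{\kappa,B}D_1+D_2$$ where $$D_1=\sum_{\substack{d>T\\ g(d)\ne 0}}g(d)\prod_{p\in\mathcal{P}}\left(1-\frac{g(p^{\nu_p(d)+1})}{g(p^{\nu_p(d)})}\right)+\sum_{\substack{d\le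 T\\ g(d)\ne 0}}g(d)\prod_{p\in\mathcal{P}}\left(1-\frac{g(p^{\nu_p(d)+1})}{g(p^{\nu_p(d)})}\right)f(u_d),$$ $$D_2=\sum_{\substack{d\le S\\ d\in\langle\mathcal{P}\rangle}}\big|\mathbb{P}(d\mid A)-g(d)\big|\left(2^{\omega(d)}+\mathbf{1}_{g(d)\ne 0}\prod_{p\in\mathcal{P}}\left(1+\frac{g(p^{\nu_p(d)+1})}{g(p^{\nu_p(d)})}\right)\right).$$ Here $u_d$ is given by $y^{u_d}=S/d$, and $f(t)=e^{-t\log t+t\log_3\max\{t,100\}+C_{\kappa,B}t}$ for a sufficiently large constant $C_{\kappa,B}$ depending only on $\kappa$ and $B$.
   Context: $\mathbb{N}=\{1,2,\dots\}$; $d$ runs over positive integers and $p$ over primes. $\nu_p(n)$ is the exponent of $p$ in $n$; $\omega(d)$ is the number of distinct prime divisors of $d$. $\langle\mathcal{P}\rangle$ is the set of positive integers divisible only by primes in $\mathcal{P}$ (it contains $1$). A multiplicative function satisfies $g(1)=1$. $\log_3 t=\log\log\log t$. $\mathbb{P}(d\mid A)$ is the probability that $d$ divides $A$. The term with $\mathbf{1}_{g(d)\neq 0}$ is read as $0$ when $g(d)=0$. For discrete random variables $X,Y$ with values in a countable set $\Omega$, $\mathrm{d}_{\mathrm{TV}}(X,Y)=\sup_{E\subseteq\Omega}|\mathbb{P}(X\in E)-\mathbb{P}(Y\in E)|$. $F\ll_{\kappa,B}G$ means $|F|\le C\,G$ with a constant $C$ depending only on $\kappa,B$. *)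

(* Defs.v *)
From HB Require Import structures.
From mathcomp Require Import all_boot all_order all_algebra finmap.
From mathcomp Require Import all_classical all_reals all_analysis.

Set Implicit Arguments.
Unset Strict Implicit.
Unset Printing Implicit Defensive.

Import Order.TTheory GRing.Theory Num.Theory.
Import numFieldNormedType.Exports.

Local Open Scope classical_set_scope.
Local Open Scope ring_scope.

Definition omega (d : nat) : nat := size (primes d).

(* <calP>: positive integers all of whose prime divisors lie in calP. *)
Definition gen_by (calP : {fset nat}) (d : nat) : bool := [pred p in calP].-nat d.

(* Arithmetic functions are functions on nat whose value at 0 is irrelevant. *)
Definition multiplicative_arith (R : realType) (g : nat -> R) : Prop :=
  g 1%N = 1 /\
  forall m n, (0 < m)%N -> (0 < n)%N -> coprime m n ->
    g (m * n)%N = g m * g n.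

Definition mutually_independent (R : realType) (dT dT' : measure_display)
    (T : measurableType dT) (T' : measurableType dT') (P : probability T R)
    (I : finType) (X : I -> {RV P >-> T'}) : Prop :=
  forall (J : {set I}) (E : I -> set T'), (forall i, measurable (E i)) ->
    P (\bigcap_(i in [set` J]) (X i @^-1` E i)) =
    (\prod_(i in J) P (X i @^-1` E i))%E.

(* Meant for discrete random variables X and Y: O is countable, and every
   X @^-1` E and Y @^-1` E is an event. *)
Definition dTV (R : realType) (d1 d2 : measure_display)
    (T1 : measurableType d1) (T2 : measurableType d2)
    (P1 : probability T1 R) (P2 : probability T2 R)
    (O : countType) (X : T1 -> O) (Y : T2 -> O) : \bar R :=
  ereal_sup
    [set `|P1 (X @^-1` E) - P2 (Y @^-1` E)|%E | E in [set: set O]].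

Definition valuations (calP : {fset nat}) (n : nat) : {ffun calP -> nat} :=
  [ffun p : calP => logn (val p) n].

Definition step_ratio (R : realType) (g : nat -> R) (p d : nat) : R :=
  g (p ^ (logn p d).+1)%N / g (p ^ logn p d)%N.

Definition u_ (R : realType) (y S : R) (d : nat) : R := ln (S / d%:R) / ln y.

Lemma u_E (R : realType) (y S : R) (d : nat) :
  1 < y -> 0 < S -> (0 < d)%N -> y `^ u_ y S d = S / d%:R.
Proof.
move=> y1 S0 d0; have y0 : 0 < y by exact: lt_trans y1.
rewrite /powR gt_eqF // /u_ divfK ?gt_eqF ?ln_gt0 //.
by rewrite lnK // posrE divr_gt0 // ltr0n.
Qed.

Definition f_decay (R : realType) (C t : R) : R :=
  expR (- (t * ln t) + t * ln (ln (ln (Num.max t 100))) + C * t).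

Definition weight (R : realType) (calP : {fset nat}) (g : nat -> R) (d : nat) : R :=
  g d * \prod_(p <- calP) (1 - step_ratio g p d).

Definition D1 (R : realType) (y S T C : R) (calP : {fset nat}) (g : nat -> R)
    : \bar R :=
  (\sum_(1 <= d <oo | (T < d%:R)%R && (g d != 0%R)) (weight calP g d)%:E +
   (\sum_(1 <= d < (Num.truncn T).+1 | g d != 0)
      weight calP g d * f_decay C (u_ y S d))%R%:E)%E.

Definition D2 (R : realType) (dO : measure_display) (Omega : measurableType dO)
    (P : probability Omega R) (A : Omega -> nat)
    (S : R) (calP : {fset nat}) (g : nat -> R) : R :=
  \sum_(1 <= d < (Num.truncn S).+1 | gen_by calP d)
    `|fine (P [set w | (d %| A w)%N]) - g d| *
    (2 ^+ omega d +
     if g d != 0 then \prod_(p <- calP) (1 + step_ratio g p d) else 0).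

(* Main.v *)
Require Import Defs.
From HB Require Import structures.
From mathcomp Require Import all_boot all_order all_algebra finmap.
From mathcomp Require Import all_classical all_reals all_analysis.
From mathcomp Require Import zify ring lra.

Set Implicit Arguments.
Unset Strict Implicit.
Unset Printing Implicit Defensive.

Import Order.TTheory GRing.Theory Num.Theory.
Import numFieldNormedType.Exports.

Local Open Scope classical_set_scope.
Local Open Scope ring_scope.

(** Only one half of the comparison has to be proved.  Write mu_G and mu_A for
    the laws of (G_p) and of (nu_p(A)).  Both have mass 1, so the total variation
    distance is the supremum over E of mu_G(E) - mu_A(E) (lemma [dTV_le]), and
    it is enough to bound mu_A from below, point by point.  A valuation vector
    is the vector of exactly one integer d in <P>, and mu_G gives it the mass
    g(d) prod_p (1 - h_d(p)) with h_d(p) = g(p^(nu_p(d)+1)) / g(p^(nu_p(d)))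
    ([independent_valuations_mass], [weight_local_mass]).  The integers d > T
    are given up: their mass is the first sum of [D1].  For d <= T the event
    nu(A) = nu(d) says that d divides A and that no p in P has p d dividing A,
    which is a sieve problem.  Lower bound sieve weights lam supported on
    squarefree m <= S/d give
      mu_A(d) >= sum_m lam(m) P(d m | A),
    and g(d m) = g(d) prod_(p | m) h_d(p) turns the right-hand side into
    g(d) sum_m lam(m) prod_(p | m) h_d(p), up to the errors P(d m | A) - g(d m).
    As |lam| <= 1, an integer n = d m <= S is met at most 2^omega(n) times when
    these errors are added over d; this is covered by [D2] ([local_lower_bound],
    [error_regroup]).

    What remains is the fundamental lemma ([fundamental_lemma]): for
    S/d = y^u there are such weights with
      sum_m lam(m) prod_(p | m) h(p) >= (1 - K f(u)) prod_p (1 - h(p)).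
    The Brun-Hooley construction provides them.  Cut the primes into blocks and
    write the sifting function as the product over blocks of V_i, the product
    of 1 - h over block i.  Truncated inclusion-exclusion inside block i, after
    an even number 2 k_i of primes, gives Y_i with V_i <= Y_i <= V_i + Z_i, where
    Z_i is the elementary symmetric function of degree 2 k_i + 1 of the h(p)
    (the Bonferroni inequalities).  Then
      prod_i Y_i - sum_j Z_j prod_(i <> j) Y_i
    is again a combination of products of h with coefficients 0, 1, -1; it is
    at most prod V_i for a 0-1 valued h, and it is at least
    (1 - sum_j Z_j / V_j) prod V_i as soon as sum_j Z_j / V_j <= 1.

    The blocks are (y^(1/l), y] with l = log u, and then the intervals whose
    endpoints have logarithms log y / (l 2^i).  The first block is allowed
    u - O(u/l) primes.  The later ones are allowed about 2 (u + i) primes each,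
    which costs only sum_i (u + i) / (l 2^i) = O(u/l) in the exponent of y
    because their primes are at most y^(1/l).  By Rankin's bound
    ([wsum_exactly_rankin]) and the hypothesis on the products of (1 - h)^-1,
    the later blocks contribute O(u^(-u)), while in the first block the sum of
    h is at most kappa log l + O(1), so that it contributes
    (log l / u)^u e^(O(u)).  Since log l = log log u, this is exactly
    f(u) = e^(-u log u + u log_3 u + O(u)).  For bounded u one has K f(u) >= 1
    and the weights can be 0. *)

(** * Inclusion-exclusion weights on the subsets of a finite set *)

(** The sums over the subsets M of U in which M is weighted by a function of its size: truncated
    inclusion-exclusion and elementary symmetric functions are both of this shape. *)
Definition wsum (R : realType) (T : finType) (a : nat -> R) (h : T -> R)
    (U : {set T}) : R :=
  \sum_(M : {set T} | M \subset U) a #|M| * \prod_(t in M) h t.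

Definition alt_upto (R : realType) (r n : nat) : R :=
  if (n <= r)%N then (-1) ^+ n else 0.

Definition exactly (R : realType) (r n : nat) : R := (n == r)%:R.

Lemma wsum0 (R : realType) (T : finType) (a : nat -> R) (h : T -> R) :
  wsum a h finset.set0 = a 0%N.
Proof.
rewrite /wsum (big_pred1 finset.set0) => [|M]; last by rewrite finset.subset0.
by rewrite cards0 big_set0 mulr1.
Qed.

(** Splitting the subsets according to whether they contain x: this recursion drives all the
    inductions below. *)
Lemma wsumU1 (R : realType) (T : finType) (a : nat -> R) (h : T -> R)
    (x : T) (U : {set T}) : x \notin U ->
  wsum a h (x |: U)%SET = wsum a h U + h x * wsum (fun n => a n.+1) h U.
Proof.
move=> xU; rewrite /wsum (bigID (fun M : {set T} => x \in M)) /= addrC.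
congr (_ + _).
  apply: eq_bigl => M; apply/andP/idP => [[/fintype.subsetP sM xM]|sM].
    apply/fintype.subsetP => t tM; have := sM t tM; rewrite !inE => /predU1P[tx|//].
    by rewrite -tx tM in xM.
  split; first exact: fintype.subset_trans sM (finset.subsetUr _ _).
  by apply: contra xU => /(fintype.subsetP sM).
rewrite mulr_sumr (reindex_onto (fun M => x |: M)%SET (fun M => M :\ x)%SET) /=.
  apply: eq_big => [M|M /andP[/andP[sM _] /eqP dM]].
    rewrite setU11 andbT; apply/andP/idP => [[sM /eqP <-]|sM].
      by rewrite finset.subDset.
    rewrite finset.setUS //; split=> //; rewrite finset.setU1K //.
    by apply: contra xU => /(fintype.subsetP sM).
  have xM : x \notin M by rewrite -dM !inE eqxx.
  by rewrite cardsU1 xM add1n big_setU1 //= mulrCA.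
by move=> M /andP[_ xM]; rewrite finset.setD1K.
Qed.

Lemma finset_ind1 (T : finType) (P : {set T} -> Prop) :
  P finset.set0 -> (forall x (U : {set T}), x \notin U -> P U -> P (x |: U)%SET) ->
  forall U, P U.
Proof.
move=> P0 PS U; move: {2}#|U| (leqnn #|U|) => n; elim: n U => [|n IH] U.
  by rewrite leqn0 cards_eq0 => /eqP ->.
have [->//|[x xU]] := set_0Vmem U.
rewrite (cardsD1 x) xU add1n ltnS => cU.
by rewrite -(finset.setD1K xU); apply: PS; [rewrite !inE eqxx|exact: IH].
Qed.

Lemma wsum_ge0 (R : realType) (T : finType) (a : nat -> R) (h : T -> R)
    (U : {set T}) : (forall n, 0 <= a n) -> (forall t, 0 <= h t) ->
  0 <= wsum a h U.
Proof.
by move=> a0 h0; apply: sumr_ge0 => M _; rewrite mulr_ge0 // prodr_ge0.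
Qed.

(** The error D_r of inclusion-exclusion truncated at size r, with the sign (-1)^r, obeys
    D_(r+1)(x |: U) = D_(r+1)(U) + h(x) D_r(U), so its positivity propagates. *)
Lemma bonferroni_sign (R : realType) (T : finType) (h : T -> R) (U : {set T}) :
  (forall t, 0 <= h t <= 1) ->
  forall r, 0 <= (-1) ^+ r * (wsum (alt_upto R r) h U - \prod_(t in U) (1 - h t)).
Proof.
move=> h01; elim/finset_ind1: U => [|x U xU IH] r.
  by rewrite wsum0 big_set0 /alt_upto /= expr0 subrr mulr0.
have V0 : 0 <= \prod_(t in U) (1 - h t) <= 1.
  apply/andP; split; first by apply: prodr_ge0 => t _; have := h01 t; lra.
  by apply: prodr_ile1 => t _; have := h01 t; lra.
rewrite wsumU1 // big_setU1 //=; set V := \prod_(t in U) _ in V0 IH *.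
(* D_r (x |: U) = D_r U + h x * D_(r-1) U, where D_(-1) is the full product. *)
have hx := h01 x.
case: r => [|r].
  have -> : wsum (fun n => alt_upto R 0 n.+1) h U = 0.
    by rewrite /wsum big1 // => M _; rewrite /alt_upto mul0r.
  have := IH 0%N; rewrite !expr0; nra.
have -> : wsum (fun n => alt_upto R r.+1 n.+1) h U = - wsum (alt_upto R r) h U.
  rewrite /wsum -sumrN; apply: eq_bigr => M _; rewrite /alt_upto ltnS.
  by case: ifP => _; rewrite ?mul0r ?oppr0 // exprS mulN1r mulNr.
have := IH r.+1; have := IH r; rewrite exprS.
set e := _ ^+ r; set a := wsum _ _ _; set b := wsum _ _ _ => Ha Hb.
have -> : -1 * e * (b + h x * - a - (1 - h x) * V) =
  -1 * e * (b - V) + h x * (e * (a - V)) by ring.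
by rewrite addr_ge0 // mulr_ge0 //; case/andP: hx.
Qed.

Lemma wsum_alt_even_ge (R : realType) (T : finType) (h : T -> R) (U : {set T}) k :
  (forall t, 0 <= h t <= 1) ->
  \prod_(t in U) (1 - h t) <= wsum (alt_upto R k.*2) h U.
Proof.
move=> h01; have := bonferroni_sign U h01 k.*2.
by rewrite -signr_odd odd_double expr0 mul1r subr_ge0.
Qed.

(** The truncations at 2k and 2k+1 differ by the elementary symmetric function of degree 2k+1,
    and the second one is below the full product. *)
Lemma wsum_alt_even_le (R : realType) (T : finType) (h : T -> R) (U : {set T}) k :
  (forall t, 0 <= h t <= 1) ->
  wsum (alt_upto R k.*2) h U <=
  \prod_(t in U) (1 - h t) + wsum (exactly R k.*2.+1) h U.
Proof.
move=> h01; have := bonferroni_sign U h01 k.*2.+1.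
have -> : wsum (alt_upto R k.*2.+1) h U =
    wsum (alt_upto R k.*2) h U - wsum (exactly R k.*2.+1) h U.
  rewrite /wsum -sumrB; apply: eq_bigr => M _; rewrite -mulrBl; congr (_ * _).
  rewrite /alt_upto /exactly leq_eqVlt ltnS; case: eqP => [->|_] /=.
    by rewrite ltnn exprS -signr_odd odd_double expr0 mulr1 sub0r.
  by rewrite subr0.
rewrite exprS -signr_odd odd_double expr0; lra.
Qed.

(** The left-hand side is one of the nonnegative terms in the expansion of the product. *)
Lemma wsum_exactly_rankin (R : realType) (T : finType) (h : T -> R) (U : {set T})
    (tau : R) r : 0 <= tau -> (forall t, 0 <= h t) ->
  tau ^+ r * wsum (exactly R r) h U <= \prod_(t in U) (1 + tau * h t).
Proof.
move=> tau0 h0; elim/finset_ind1: U r => [|x U xU IH] r.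
  by rewrite wsum0 big_set0 /exactly; case: r => [|r]; rewrite ?expr0 ?mulr0 ?mul1r.
rewrite wsumU1 // big_setU1 //= mulrDl mul1r; case: r => [|r].
  have -> : wsum (fun n => exactly R 0 n.+1) h U = 0.
    by rewrite /wsum big1 // => M _; rewrite mul0r.
  rewrite mulr0 addr0; apply: (le_trans (IH 0%N)).
  by rewrite lerDl !mulr_ge0 // prodr_ge0 // => t _; rewrite addr_ge0 // mulr_ge0.
rewrite mulrDr lerD // [X in _ * (_ * X)](_ : _ = wsum (exactly R r) h U) //.
rewrite exprS mulrACA; apply: ler_wpM2l; [exact: mulr_ge0|exact: IH].
Qed.

(** A set is the same as the family of its intersections with the fibres of c. *)
Lemma subsets_blocks (R : realType) (T I : finType) (c : T -> I)
    (phi : I -> {set T} -> R) :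
  \sum_(M : {set T}) \prod_i phi i (M :&: [set t | c t == i])%SET =
  \prod_i \sum_(M : {set T} | M \subset [set t | c t == i]%SET) phi i M.
Proof.
rewrite bigA_distr_big_dep /=.
(* The bijection between sets and families of subsets of the fibres, and its inverse. *)
pose F (M : {set T}) : {ffun I -> {set T}} := [ffun i => M :&: [set t | c t == i]]%SET.
pose G (f : {ffun I -> {set T}}) : {set T} := [set t | t \in f (c t)]%SET.
rewrite [RHS](reindex_onto F G) /=.
  apply: eq_big => [M|M _]; last by apply: eq_bigr => i _; rewrite ffunE.
  apply/esym/andP; split.
    by apply/familyP => i; rewrite ffunE; exact: finset.subsetIr.
  by apply/eqP/setP => t; rewrite !inE ffunE !inE eqxx andbT.
move=> f /familyP fF; apply/ffunP => i; rewrite ffunE; apply/setP => t; rewrite !inE.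
apply/andP/idP => [[tf /eqP <-]//|tf].
by have := fintype.subsetP (fF i) t tf; rewrite inE => /eqP cti; rewrite cti.
Qed.

(** * Brun-Hooley weights *)

Definition block (T I : finType) (c : T -> I) (i : I) : {set T} :=
  [set t | c t == i]%SET.

(** The coefficient of prod_(t in M) h t in the expansion of
    prod_i Y_i - sum_j Z_j prod_(i != j) Y_i, where Y_i and Z_i are the truncated alternating sum
    and the first omitted symmetric function of the block i. *)
Definition brun_hooley (R : realType) (T I : finType) (c : T -> I) (k : I -> nat)
    (M : {set T}) : R :=
  \prod_i alt_upto R (k i).*2 #|(M :&: block c i)%SET|
  - \sum_j \prod_i (if i == j then exactly R (k i).*2.+1 else alt_upto R (k i).*2)
      #|(M :&: block c i)%SET|.

Lemma prod_blocks (R : realType) (T I : finType) (c : T -> I) (h : T -> R)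
    (M : {set T}) :
  \prod_(t in M) h t = \prod_i \prod_(t in (M :&: block c i)%SET) h t.
Proof.
rewrite (partition_big c xpredT) //=; apply: eq_bigr => i _.
by apply: eq_bigl => t; rewrite !inE.
Qed.

Lemma sum_block_weights (R : realType) (T I : finType) (c : T -> I)
    (a : I -> nat -> R) (h : T -> R) :
  \sum_(M : {set T}) (\prod_i a i #|(M :&: block c i)%SET|) * \prod_(t in M) h t
  = \prod_i wsum (a i) h (block c i).
Proof.
rewrite -(subsets_blocks c (fun i M => a i #|M| * \prod_(t in M) h t)).
by apply: eq_bigr => M _; rewrite (prod_blocks c h M) -big_split.
Qed.

Lemma sum_brun_hooley (R : realType) (T I : finType) (c : T -> I) (k : I -> nat)
    (h : T -> R) :
  \sum_(M : {set T}) brun_hooley R c k M * \prod_(t in M) h t =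
  \prod_i wsum (alt_upto R (k i).*2) h (block c i)
  - \sum_j \prod_i (if i == j then wsum (exactly R (k i).*2.+1) h (block c i)
                    else wsum (alt_upto R (k i).*2) h (block c i)).
Proof.
rewrite -sum_block_weights.
under [X in _ = _ - X]eq_bigr => j _.
  under eq_bigr => i _ do
    rewrite -(fun_if (fun a => wsum a h (block c i))).
  rewrite -(sum_block_weights c (fun i =>
    if i == j then exactly R (k i).*2.+1 else alt_upto R (k i).*2) h).
  over.
rewrite exchange_big -sumrB; apply: eq_bigr => M _.
by rewrite /brun_hooley mulrBl mulr_suml.
Qed.

Lemma alt_upto_norm_le1 (R : realType) r n : `|alt_upto R r n| <= 1.
Proof. by rewrite /alt_upto; case: ifP => _; rewrite ?normr0 // normrX normrN1 expr1n. Qed.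

Lemma prod_norm_le1 (R : realType) (I : finType) (F : I -> R) :
  (forall i, `|F i| <= 1) -> `|\prod_i F i| <= 1.
Proof. by move=> F1; rewrite normr_prod; apply: prodr_ile1 => i _; rewrite normr_ge0 F1. Qed.

(** At most one of the products in the definition is nonzero: the first one needs every block to
    hold at most 2 k_i elements of M, and the one of index j needs exactly 2 k_j + 1 elements in
    the block j and at most 2 k_i in the others. *)
Lemma brun_hooley_norm_support (R : realType) (T I : finType) (c : T -> I) (k : I -> nat)
    (M : {set T}) (i0 : I) :
  `|brun_hooley R c k M| <= 1 /\
  (brun_hooley R c k M != 0 ->
   exists j, forall i, (#|(M :&: block c i)%SET| <= (k i).*2 + (i == j))%N).
Proof.
have abs1 j i n : `|(if i == j then exactly R (k i).*2.+1 else alt_upto R (k i).*2) n| <= 1.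
  case: eqP => _; last exact: alt_upto_norm_le1.
  by rewrite /exactly; case: eqP; rewrite ?normr1 ?normr0.
have [/existsP[j kj]|/existsPn small] :=
    boolP [exists j, (k j).*2 < #|(M :&: block c j)%SET|]%N.
  have E : brun_hooley R c k M =
    - \prod_i (if i == j then exactly R (k i).*2.+1 else alt_upto R (k i).*2)
      #|(M :&: block c i)%SET|.
    rewrite /brun_hooley [X in X - _](bigD1 j) //= {1}/alt_upto leqNgt kj mul0r sub0r.
    congr (- _); rewrite (bigD1 j) //= [X in _ + X]big1 ?addr0 // => j' jj'.
    by rewrite (bigD1 j) //= eq_sym (negPf jj') /alt_upto leqNgt kj mul0r.
  split; first by rewrite E normrN prod_norm_le1.
  rewrite E oppr_eq0 => /prodf_neq0 nz; exists j => i; have := nz i isT.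
  have [->|_] := eqVneq i j.
    by rewrite /exactly addn1 pnatr_eq0 eqb0 negbK => /eqP ->.
  by rewrite addn0 /alt_upto; case: ifP => // _; rewrite eqxx.
have sm i : (#|(M :&: block c i)%SET| <= (k i).*2)%N by rewrite leqNgt small.
split; last by move=> _; exists i0 => i; rewrite (leq_trans (sm i)) // leq_addr.
rewrite /brun_hooley [X in _ - X]big1 ?subr0; last first.
  move=> j _; rewrite (bigD1 j) //= eqxx /exactly; case: eqP => [e|]; rewrite ?mul0r //.
  by have := sm j; rewrite e ltnn.
by apply: prod_norm_le1 => i; exact: alt_upto_norm_le1.
Qed.

(** Evaluate the polynomial at the indicator function of Q.  If Q meets the block j then V_j = 0,
    hence Y_j <= Z_j, and the term of index j alone makes up for prod_i Y_i. *)
Lemma brun_hooley_sieve_le (R : realType) (T I : finType) (c : T -> I) (k : I -> nat)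
    (Q : {set T}) (i0 : I) :
  \sum_(M : {set T} | M \subset Q) brun_hooley R c k M <= (Q == finset.set0)%:R.
Proof.
case: eqP => [->|/eqP Q0].
  rewrite (big_pred1 finset.set0) => [|M]; last by rewrite finset.subset0.
  have [b1 _] := brun_hooley_norm_support R c k finset.set0 i0.
  by rewrite (le_trans _ b1) // ler_norm.
pose h (t : T) : R := (t \in Q)%:R.
have h01 t : 0 <= h t <= 1 by rewrite /h; case: (t \in Q); rewrite ?lexx ler01.
have -> : \sum_(M : {set T} | M \subset Q) brun_hooley R c k M =
   \sum_(M : {set T}) brun_hooley R c k M * \prod_(t in M) h t.
  rewrite big_mkcond; apply: eq_bigr => M _; case: ifPn => [/fintype.subsetP sM|nM].
    by rewrite big1 ?mulr1 // => t /sM; rewrite /h => ->.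
  have [t tM tQ] := fintype.subsetPn nM.
  by rewrite (bigD1 t) //= /h (negPf tQ) mul0r mulr0.
rewrite sum_brun_hooley.
have [t tQ] := finset.set0Pn _ Q0; pose j := c t.
have Ypos i : 0 <= wsum (alt_upto R (k i).*2) h (block c i).
  apply: le_trans (wsum_alt_even_ge _ _ h01).
  by apply: prodr_ge0 => s _; have := h01 s; lra.
have Zpos i : 0 <= wsum (exactly R (k i).*2.+1) h (block c i).
  by apply: wsum_ge0 => s; [rewrite /exactly ler0n|have /andP[] := h01 s].
rewrite subr_le0 (bigD1 j (F := fun j => \prod_i _)) //=.
rewrite -[leLHS]addr0 lerD //; last first.
  by apply: sumr_ge0 => i _; apply: prodr_ge0 => i' _; case: ifP.
rewrite [leRHS](bigD1 j) //= eqxx (bigD1 j) //=.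
under [X in _ <= _ * X]eq_bigr => i /negPf -> do [].
apply: ler_wpM2r; first exact: prodr_ge0.
apply: le_trans (wsum_alt_even_le _ _ h01) _.
rewrite (bigD1 t) //=; last by rewrite inE.
by rewrite {1}/h tQ subrr mul0r add0r.
Qed.

(** Factor out prod_i Y_i: what is left is 1 - sum_j Z_j / Y_j, and V_j <= Y_j. *)
Lemma brun_hooley_main_term (R : realType) (T I : finType) (c : T -> I)
    (k : I -> nat) (h : T -> R) (E : I -> R) :
  (forall t, 0 <= h t < 1) ->
  (forall i, wsum (exactly R (k i).*2.+1) h (block c i) <=
     E i * \prod_(t in block c i) (1 - h t)) ->
  \sum_i E i <= 1 ->
  (1 - \sum_i E i) * \prod_t (1 - h t) <=
  \sum_(M : {set T}) brun_hooley R c k M * \prod_(t in M) h t.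
Proof.
move=> h01 HE E1; rewrite sum_brun_hooley.
have h01' t : 0 <= h t <= 1 by have := h01 t; lra.
pose V i := \prod_(t in block c i) (1 - h t).
pose Y i := wsum (alt_upto R (k i).*2) h (block c i).
have V0 i : 0 < V i by apply: prodr_gt0 => t _; have := h01 t; lra.
have VY i : V i <= Y i by exact: wsum_alt_even_ge.
have Z0 i : 0 <= wsum (exactly R (k i).*2.+1) h (block c i).
  by apply: wsum_ge0 => s; [rewrite /exactly ler0n|have /andP[] := h01 s].
have E0 i : 0 <= E i.
  have := le_trans (Z0 i) (HE i); rewrite pmulr_lge0 //; exact: V0.
have -> : \prod_t (1 - h t) = \prod_i V i.
  rewrite (partition_big c xpredT) //=; apply: eq_bigr => i _.
  by apply: eq_bigl => t; rewrite inE.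
have VYprod : \prod_i V i <= \prod_i Y i.
  by apply: ler_prod => i _; rewrite VY ltW.
apply: le_trans (_ : (1 - \sum_i E i) * \prod_i Y i <= _).
  by apply: ler_wpM2l => //; rewrite subr_ge0.
rewrite mulrBl mul1r lerD2l lerN2 mulr_suml; apply: ler_sum => j _.
rewrite (bigD1 j) //= eqxx [X in _ <= _ * X](bigD1 j) //= mulrA.
have -> : \prod_(i | i != j) (if i == j then wsum (exactly R (k i).*2.+1) h (block c i)
    else wsum (alt_upto R (k i).*2) h (block c i)) = \prod_(i | i != j) Y i.
  by apply: eq_bigr => i /negPf ->.
apply: ler_wpM2r.
  by apply: prodr_ge0 => i _; exact: le_trans (ltW (V0 i)) (VY i).
exact: le_trans (HE j) (ler_wpM2l (E0 j) (VY j)).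
Qed.

(** * Elementary estimates *)

Lemma ln100_gt1 (R : realType) : 1 < ln (100 : R).
Proof.
rewrite -[ltLHS](@expRK R 1) ltr_ln ?posrE ?expR_gt0 //.
have h := expR_ge1Dx (- (1 / 2) : R).
have e : expR (- (1 / 2) : R) * expR (- (1 / 2)) * expR 1 = 1.
  by rewrite -!expRD (_ : _ + _ = 0) ?expR0 //; lra.
have p := expR_gt0 (1 : R).
have h4 : 1 / 4 <= expR (- (1 / 2) : R) * expR (- (1 / 2)) by nra.
have q : 1 / 4 * expR (1:R) <= 1 by rewrite -[leRHS]e ler_pM2r.
lra.
Qed.

Lemma expR_ge_sub1V (R : realType) (x : R) : x < 1 -> expR x <= (1 - x)^-1.
Proof.
move=> x1; have := expR_ge1Dx (- x); rewrite expRN => h.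
rewrite -[leLHS]invrK lef_pV2 ?posrE ?invr_gt0 ?expR_gt0 //; lra.
Qed.

Lemma geometric_half_sum (R : realType) n : \sum_(i < n) (1 / 2 : R) ^+ i <= 2.
Proof.
have -> : \sum_(i < n) (1 / 2 : R) ^+ i = 2 - 2 * (1 / 2) ^+ n.
  elim: n => [|n IH]; first by rewrite big_ord0 expr0; lra.
  by rewrite big_ord_recr /= IH exprS; field.
have p : 0 <= (1 / 2 : R) ^+ n by rewrite exprn_ge0.
lra.
Qed.

Lemma arith_geometric_half_sum (R : realType) (a : R) n : 0 <= a ->
  \sum_(i < n) (a + i%:R) / 2 ^+ i <= 2 * a + 2.
Proof.
move=> a0.
have -> : \sum_(i < n) (a + i%:R) / 2 ^+ i
    = 2 * a + 2 - (2 * a + 2 * n%:R + 2) / 2 ^+ n.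
  elim: n => [|n IH]; first by rewrite big_ord0 expr0; field.
  rewrite big_ord_recr /= IH exprS -natr1; field.
  by rewrite expf_neq0.
rewrite gerBl divr_ge0 ?exprn_ge0 //.
by have : 0 <= n%:R :> R by []; lra.
Qed.

(** Here m = log log u, the mass of the block is kap * m + b, and the choice tau = n / m balances
    tau * kap * m against n ln tau.  This produces the factor m^n, that is the term
    u * ln (ln (ln u)) of [f_decay]. *)
Lemma first_block_error (R : realType) (kap b u : R) (n : nat) :
  0 <= kap -> 0 <= b -> 100 <= ln u ->
  u - 6 * u / ln u <= n%:R -> n%:R <= u ->
  expR ((n%:R / ln (ln u) + 1) * (kap * ln (ln u) + b)
        - n%:R * ln (n%:R / ln (ln u)))
  <= expR (- (u * ln u) + u * ln (ln (ln u)) + (7 + 2 * kap + 2 * b) * u).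
Proof.
move=> kap0 b0 l100 nl nu; rewrite ler_expR.
have u0 : 0 < u by rewrite ltNge; apply/negP => /ln0; lra.
set l := ln u in l100 nl *.
have lu : l < u by exact: ln_sublinear.
have m1 : 1 <= ln l.
  apply: le_trans (ltW (ln100_gt1 R)) _; rewrite ler_ln ?posrE //; lra.
have ml : ln l < l by apply: ln_sublinear; lra.
set m := ln l in m1 ml *.
have d1 : u / l <= u / 100 by rewrite ler_pM2l // lef_pV2 ?posrE //; lra.
have n2 : u / 2 <= n%:R by move: nl; rewrite -mulrA; lra.
have n0 : 0 < n%:R :> R by lra.
rewrite ln_div ?posrE //; last lra.
have lnn : l - 1 <= ln n%:R.
  have : ln (u / 2) <= ln n%:R by rewrite ler_ln ?posrE //; lra.
  rewrite ln_div ?posrE // -/l.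
  have : ln (2 : R) <= 1.
    by have := @le_ln1Dx R 1; rewrite (_ : 1 + 1 = 2) // => ->.
  lra.
have A : (n%:R / m + 1) * (kap * m + b) <= 2 * kap * u + 2 * b * u.
  have -> : (n%:R / m + 1) * (kap * m + b) = n%:R * kap + n%:R / m * b + kap * m + b.
    by field; lra.
  have : n%:R / m <= u.
    apply: le_trans nu; rewrite ler_pdivrMr ?ler_peMr //; lra.
  have : 0 <= n%:R / m by rewrite divr_ge0 //; lra.
  nra.
have B : n%:R * ln m <= u * ln m by apply: ler_wpM2r => //; exact: ln_ge0.
have C : u * l - 7 * u <= n%:R * ln n%:R.
  apply: le_trans (_ : (u - 6 * u / l) * (l - 1) <= _); last first.
    apply: ler_pM => //; last lra.
    by move: d1; rewrite -mulrA; lra.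
  have -> : (u - 6 * u / l) * (l - 1) = u * l - 7 * u + 6 * u / l by field; lra.
  by rewrite lerDl divr_ge0 //; lra.
by move: A B C; rewrite mulrBr; lra.
Qed.

(** The mass w of the block is bounded, so tau = n is good enough.  Having at least 2 u + i primes
    leaves room for the factor (1/2)^i that makes the blocks summable. *)
Lemma later_block_error (R : realType) (w u : R) (n0 i : nat) :
  0 <= w -> 100 + 2 * w <= ln u -> u <= n0%:R ->
  expR (((n0 + i).*2.+1%:R + 1) * w - (n0 + i).*2.+1%:R * ln ((n0 + i).*2.+1%:R))
  <= expR (w - u * ln u) * (1 / 2) ^+ i.
Proof.
move=> w0 lw un.
have u0 : 0 < u by rewrite ltNge; apply/negP => /ln0; lra.
set n := (n0 + i).*2.+1.
have nE : n%:R = 2 * n0%:R + 2 * i%:R + 1 :> R.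
  by rewrite /n -natr1 -addnn natrD natrD; ring.
have i0 : 0 <= i%:R :> R by [].
have lnn : ln u <= ln n%:R by rewrite ler_ln ?posrE //; lra.
have -> : (1 / 2 : R) ^+ i = expR (- (i%:R * ln 2)).
  by rewrite expRN expRM_natl lnK ?posrE // div1r exprVn.
rewrite -expRD ler_expR.
have l2 : ln (2 : R) <= 1.
  by have := @le_ln1Dx R 1; rewrite (_ : 1 + 1 = 2) // => ->.
set l := ln u in lw lnn *; set ln_n := ln n%:R in lnn *.
have n1 : 0 <= n%:R :> R by [].
have : n%:R * (l - w) <= n%:R * (ln_n - w) by apply: ler_wpM2l => //; lra.
have : (2 * u + i%:R) * (l - w) <= n%:R * (l - w).
  by apply: ler_wpM2r; lra.
have : u * l <= 2 * u * (l - w) by nra.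
have : i%:R * ln 2 <= i%:R * (l - w) by apply: ler_wpM2l => //; lra.
nra.
Qed.

(** * Geometric blocks of primes *)

(** With tau > 0, the symmetric function is at most tau^(-r) exp(tau sum h), and both sum h and
    the logarithm of the inverse of prod (1 - h) are at most w. *)
Lemma rankin_block (R : realType) (T : finType) (h : T -> R) (U : {set T})
    (w tau : R) r :
  (forall t, 0 <= h t < 1) -> 0 < tau ->
  \prod_(t in U) (1 - h t)^-1 <= expR w ->
  wsum (exactly R r) h U <=
  expR ((tau + 1) * w - r%:R * ln tau) * \prod_(t in U) (1 - h t).
Proof.
move=> h01 tau0 Vw; set V := \prod_(t in U) (1 - h t).
have h0 t : 0 <= h t by case/andP: (h01 t).
have V0 : 0 < V by apply: prodr_gt0 => t _; have := h01 t; lra.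
have wh : \sum_(t in U) h t <= w.
  rewrite -ler_expR (le_trans _ Vw) // expR_sum; apply: ler_prod => t _.
  by rewrite expR_ge0 expR_ge_sub1V //; case/andP: (h01 t).
have Vge : 1 <= expR w * V.
  by move: Vw; rewrite prodfV -/V -[X in _ -> X <= _](mulVf (lt0r_neq0 V0)) ler_pM2r.
have P : \prod_(t in U) (1 + tau * h t) <= expR (tau * w).
  apply: le_trans (_ : expR (tau * \sum_(t in U) h t) <= _).
    rewrite mulr_sumr expR_sum; apply: ler_prod => t _.
    by rewrite expR_ge1Dx andbT addr_ge0 // mulr_ge0 // ltW.
  by rewrite ler_expR ler_wpM2l // ltW.
have Rk := le_trans (wsum_exactly_rankin U r (ltW tau0) h0) P.
have -> : expR ((tau + 1) * w - r%:R * ln tau) * V =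
    tau ^- r * expR (tau * w) * (expR w * V).
  rewrite mulrDl mul1r -addrA [w - _]addrC addrA expRD expRD expRN.
  rewrite expRM_natl lnK ?posrE //; ring.
apply: le_trans (_ : tau ^- r * expR (tau * w) <= _).
  by rewrite ler_pdivlMl // exprn_gt0.
by rewrite ler_peMr // mulr_ge0 ?expR_ge0 // invr_ge0 exprn_ge0 // ltW.
Qed.

(** The logarithms of the endpoints of the blocks, in decreasing order. *)
Definition cut (R : realType) (L ell : R) (j : nat) : R :=
  if j is j'.+1 then L / (ell * 2 ^+ j') else L.

Lemma cut_ge0 (R : realType) (L ell : R) j : 0 <= L -> 0 <= ell -> 0 <= cut L ell j.
Proof. by case: j => [|j] //= L0 l0; rewrite divr_ge0 // mulr_ge0 // exprn_ge0. Qed.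

Lemma cut_leL (R : realType) (L ell : R) j : 0 <= L -> 1 <= ell -> cut L ell j <= L.
Proof.
case: j => [|j] //= L0 l0; rewrite ler_pdivrMr; last first.
  by apply: mulr_gt0; [lra|exact: exprn_gt0].
by rewrite ler_peMr // mulr_ege1 // exprn_ege1 // ler1n.
Qed.

Lemma choose_blocks (R : realType) (T : finType) (l : T -> R) (L ell : R) :
  0 < L -> 1 <= ell -> (forall t, ln 2 <= l t <= L) ->
  exists (N : nat) (c : T -> 'I_N.+1),
    forall t, cut L ell (c t).+1 < l t <= cut L ell (c t).
Proof.
move=> L0 l1 lL; pose N := Num.truncn (L / ln 2).
have ln2 : 0 < ln (2 : R) by apply: ln_gt0; lra.
exists N.
have cutN : cut L ell N.+1 < ln 2.
  rewrite /= ltr_pdivrMr; last by apply: mulr_gt0; [lra|exact: exprn_gt0].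
  rewrite -ltr_pdivrMl // mulrC.
  apply: lt_le_trans (truncnS_gt _) _; rewrite -/N.
  apply: le_trans (_ : 2 ^+ N <= _); first by rewrite -natrX ler_nat ltn_expl.
  by rewrite ler_peMl // exprn_ge0.
suff H t : exists i : 'I_N.+1, cut L ell i.+1 < l t <= cut L ell i.
  by have [c Hc] := fin_all_exists H; exists c.
have ex : exists n, cut L ell n.+1 < l t.
  by exists N; apply: lt_le_trans cutN _; case/andP: (lL t).
have [m Hm mmin] := ex_minnP ex.
have mN : (m < N.+1)%N.
  by rewrite ltnS; apply: mmin; apply: lt_le_trans cutN _; case/andP: (lL t).
exists (Ordinal mN); rewrite /= Hm /=.
case: m Hm mmin mN => [|m] Hm mmin mN; first by case/andP: (lL t).
by rewrite leNgt; apply/negP => /mmin; rewrite ltnn.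
Qed.

(** The bound on prod_(a <= p <= b) (1 - h p)^-1, in the variables al = ln a and be = ln b, with
    l p = ln p. *)
Definition sieve_dimension (R : realType) (T : finType) (l h : T -> R)
    (kap B L : R) : Prop :=
  forall al be, ln 2 <= al -> al <= be -> be <= L ->
    \prod_(t | al <= l t <= be) (1 - h t)^-1 <= (be / al) `^ kap * expR (B / al).

(** Elements are at least ln 2, so the bound on products may be used from max (ln 2) z' on. *)
Lemma block_mass (R : realType) (T : finType) (l h : T -> R) (kap B L : R)
    (U : {set T}) (z z' rho : R) :
  0 <= kap -> 0 < B -> (forall t, 0 <= h t < 1) -> (forall t, ln 2 <= l t) ->
  sieve_dimension l h kap B L ->
  z <= L -> 1 <= rho -> z <= rho * z' -> 0 < z' ->
  (forall t, t \in U -> z' < l t <= z) ->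
  \prod_(t in U) (1 - h t)^-1 <= expR (kap * ln rho + B / ln 2).
Proof.
move=> kap0 B0 h01 l2 dim zL rho1 zr z'0 Uz.
have ln2 : 0 < ln (2 : R) by apply: ln_gt0; lra.
have w0 : 0 <= kap * ln rho + B / ln 2.
  by apply: addr_ge0; [rewrite mulr_ge0 // ln_ge0|rewrite divr_ge0 // ltW].
have [z2|z2] := ltP z (ln 2).
  rewrite big1 => [|t /Uz tz]; last by have lt2 := l2 t; exfalso; lra.
  by rewrite -[leLHS]expR0 ler_expR.
pose al := Num.max (ln 2) z'.
have al2 : ln 2 <= al by rewrite /al le_max lexx.
have [alz|alz] := leP al z; last first.
  rewrite big1 => [|t /Uz tz]; last first.
    by exfalso; move: alz; rewrite /al lt_max => /orP[]; have lt2 := l2 t; lra.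
  by rewrite -[leLHS]expR0 ler_expR.
apply: le_trans (_ : \prod_(t | al <= l t <= z) (1 - h t)^-1 <= _).
  rewrite [leRHS](bigID (mem U)) /= [X in _ <= X * _](_ : _ = \prod_(t in U) (1 - h t)^-1).
    rewrite ler_peMr //.
      by apply: prodr_ge0 => t _; rewrite invr_ge0; have := h01 t; lra.
    apply: (big_ind (fun x => 1 <= x)) => // [a b|t _]; first exact: mulr_ege1.
    by rewrite invf_ge1; have := h01 t; lra.
  apply: eq_bigl => t; apply/andP/idP => [[]//|tU]; split=> //.
  by have := Uz t tU; rewrite /al ge_max l2 /= => /andP[/ltW -> ->].
apply: le_trans (dim al z al2 alz zL) _.
rewrite expRD; apply: ler_pM; rewrite ?powR_ge0 ?expR_ge0 //.
  have q0 : 0 < z / al by rewrite divr_gt0 //; lra.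
  rewrite /powR gt_eqF // ler_expR ler_wpM2l // ler_ln ?posrE //; last lra.
  rewrite ler_pdivrMr; last lra.
  apply: le_trans zr _; apply: ler_wpM2l; first lra.
  by rewrite /al le_max lexx orbT.
by rewrite ler_expR ler_pM2l // lef_pV2 // posrE; lra.
Qed.

(** The single block that may hold one more element costs at most one extra L. *)
Lemma block_level (R : realType) (T : finType) (l : T -> R) (N : nat)
    (c : T -> 'I_N.+1) (M : {set T}) (L ell : R) (k : nat -> nat) (j : 'I_N.+1) :
  0 <= L -> 1 <= ell ->
  (forall t, l t <= cut L ell (c t)) ->
  (forall i : 'I_N.+1, (#|(M :&: block c i)%SET| <= (k i).*2 + (i == j))%N) ->
  \sum_(t in M) l t <= L + \sum_(i < N.+1) (k i).*2%:R * cut L ell i.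
Proof.
move=> L0 l1 lc kM.
rewrite (partition_big c xpredT) //=.
apply: le_trans (_ : \sum_(i < N.+1) ((i == j)%:R * cut L ell i + (k i).*2%:R * cut L ell i) <= _).
  apply: ler_sum => i _.
  rewrite -mulrDl -natrD addnC.
  apply: le_trans (_ : \sum_(t in (M :&: block c i)%SET) cut L ell i <= _).
    rewrite [leRHS](eq_bigl (fun t => (t \in M) && (c t == i))); last first.
      by move=> t; rewrite !inE.
    by apply: ler_sum => t /andP[_ /eqP <-].
  rewrite sumr_const -[leLHS]mulr_natl ler_wpM2r ?ler_nat //.
  by rewrite cut_ge0 //; lra.
rewrite big_split /= lerD2r (bigD1 j) //= eqxx mul1r big1 ?addr0 ?cut_leL //.
by move=> i /negPf ->; rewrite mul0r.
Qed.

(** * The fundamental lemma, from below *)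

Lemma f_decay_ge0 (R : realType) (C u : R) : 0 <= f_decay C u.
Proof. exact: expR_ge0. Qed.

Lemma f_decay_mono (R : realType) (C C' u : R) :
  0 <= u -> C <= C' -> f_decay C u <= f_decay C' u.
Proof. by move=> u0 CC; rewrite /f_decay ler_expR lerD2l ler_wpM2r. Qed.

(** On a bounded range of u the function is at least 1 once C is large. *)
Lemma f_decay_ge1 (R : realType) (C u m : R) :
  1 <= u -> ln u <= m -> m - ln (ln (ln 100)) <= C -> 1 <= f_decay C u.
Proof.
move=> u1 um mC; rewrite /f_decay -[leLHS]expR0 ler_expR.
have l1 := ln100_gt1 R.
set x := Num.max u 100.
have l2 : ln (ln (ln 100)) <= ln (ln (ln x)).
  have h : ln (100 : R) <= ln x.
    by rewrite ler_ln ?posrE // /x ?le_max ?lt_max ?lexx ?orbT // (lt_le_trans _ u1).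
  have p1 : 0 < ln (ln (100 : R)) by exact: ln_gt0.
  have h2 : ln (ln (100 : R)) <= ln (ln x) by rewrite ler_ln ?posrE //; lra.
  by rewrite ler_ln ?posrE //; lra.
nra.
Qed.

(** The Brun-Hooley weights for the blocks of [choose_blocks], with ell = ln u.  The truncation
    k0 of the first block is the largest one that keeps the support below u * L. *)
Lemma lower_sieve_large (R : realType) (kap B : R) (T : finType) (l h : T -> R)
    (L u : R) :
  0 <= kap -> 0 < B ->
  100 + 2 * (kap * ln 2 + B / ln 2) <= ln u ->
  0 < L -> (forall t, ln 2 <= l t <= L) -> (forall t, 0 <= h t < 1) ->
  sieve_dimension l h kap B L ->
  let K := 1 + 2 * expR (kap * ln 2 + B / ln 2) in
  let C := 7 + 2 * kap + 2 * (B / ln 2) in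
  K * f_decay C u <= 1 ->
  exists lam : {set T} -> R,
    [/\ forall M, `|lam M| <= 1,
        forall M, lam M != 0 -> \sum_(t in M) l t <= u * L,
        forall Q : {set T}, \sum_(M : {set T} | M \subset Q) lam M <= (Q == finset.set0)%:R
      & (1 - K * f_decay C u) * \prod_t (1 - h t) <=
        \sum_(M : {set T}) lam M * \prod_(t in M) h t].
Proof.
move=> kap0 B0 lu L0 lL h01 dim K C KC1.
have ln2 : 0 < ln (2 : R) by apply: ln_gt0; lra.
set b := B / ln 2; rewrite -/b in lu K C KC1 *.
have b0 : 0 <= b by rewrite divr_ge0 // ltW.
set w := kap * ln 2 + b; rewrite -/w in lu K C KC1 *.
have w0 : 0 <= w by rewrite addr_ge0 // mulr_ge0 // ltW.
have u0 : 0 < u by rewrite ltNge; apply/negP => /ln0; lra.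
set ell := ln u in lu *.
have ell100 : 100 <= ell by lra.
have ell0 : 0 < ell by lra.
have ell4 : ell + 4 <= u.
  rewrite -[leRHS]lnK // -/ell.
  have := @expR_ge1Dxn R ell 1 (ltW ell0); rewrite (_ : 2`!%:R = 2 :> R) //.
  nra.
have lnell0 : 0 < ln ell by apply: ln_gt0; lra.
have [N [c Hc]] := @choose_blocks R T l L ell L0 ltac:(lra) lL.
(* The later blocks use at most (4 u + 8) / ell of the level u, and the exceptional
extra element uses 1. *)
have lev0 : 0 <= (u - 1 - (4 * u + 8) / ell) / 2.
  apply: divr_ge0 => //.
  have : (4 * u + 8) / ell <= (4 * u + 8) / 100.
    by rewrite ler_pM2l ?lef_pV2 ?posrE //; lra.
  lra.
pose k0 := Num.truncn ((u - 1 - (4 * u + 8) / ell) / 2).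
have /andP[k0l k0u] := truncn_itv lev0; rewrite -/k0 in k0l k0u.
have k0E : k0.*2.+1%:R = 2 * k0%:R + 1 :> R.
  by rewrite -natr1 -addnn natrD; ring.
have q8 : (4 * u + 8) / ell = 4 * (u / ell) + 8 / ell by field; lra.
have q0 : 0 <= (4 * u + 8) / ell by rewrite divr_ge0 //; lra.
have n_lo : u - 6 * u / ell <= k0.*2.+1%:R.
  rewrite k0E; apply: le_trans (_ : u - 2 - (4 * u + 8) / ell <= _).
    have -> : u - 6 * u / ell = u - 2 - (4 * u + 8) / ell - 2 * (u - ell - 4) / ell.
      by field; lra.
    by rewrite gerBl divr_ge0 //; lra.
  by move: k0u; rewrite -natr1; lra.
have n_hi : k0.*2.+1%:R <= u by rewrite k0E; lra.
pose n0 := (Num.truncn u).+1.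
have n0u : u <= n0%:R by apply: ltW; exact: truncnS_gt.
have n0l : n0%:R <= u + 1.
  by rewrite /n0 -natr1 lerD2r; have /andP[] := truncn_itv (ltW u0).
pose k (j : nat) := if j is j'.+1 then (n0 + j')%N else k0.
(* The parameters of Rankin's bound, chosen as in the two error estimates. *)
pose tau (j : nat) : R :=
  if j is _.+1 then (k j).*2.+1%:R else (k j).*2.+1%:R / ln ell.
pose v (j : nat) : R := if j is _.+1 then w else kap * ln ell + b.
pose E (j : nat) : R :=
  expR ((tau j + 1) * v j - (k j).*2.+1%:R * ln (tau j)).
have tau0 j : 0 < tau j.
  case: j => [|j] /=; rewrite ?ltr0n // divr_gt0 // ltr0n.
have l2 t : ln 2 <= l t by case/andP: (lL t).
have Emass (i : 'I_N.+1) : wsum (exactly R (k i).*2.+1) h (block c i) <=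
    E i * \prod_(t in block c i) (1 - h t).
  apply: rankin_block => //.
  have Hz t : t \in block c i -> cut L ell i.+1 < l t <= cut L ell i.
    by rewrite inE => /eqP <-; exact: Hc.
  have cutpos j : 0 < cut L ell j.+1.
    by rewrite /= divr_gt0 // mulr_gt0 // exprn_gt0.
  have ell1 : 1 <= ell by lra.
  have cl := cut_leL i (ltW L0) ell1.
  case: i Hz cl => -[|j] ji Hz cl.
    apply: (@block_mass _ _ l h kap B L _ L (cut L ell 1)) => //.
    by rewrite /= expr0 mulr1 mulrCA divff ?mulr1 //; lra.
  apply: (@block_mass _ _ l h kap B L _ (cut L ell j.+1) (cut L ell j.+2)) => //.
    lra.
  rewrite /= exprS (_ : 2 * _ = L / (ell * 2 ^+ j)) //; field.
  by rewrite expf_neq0 //=; lra.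
have Etot : \sum_(i < N.+1) E i <= K * f_decay C u.
  rewrite big_ord_recl /=.
  have E0 : E 0%N <= f_decay C u.
    rewrite /f_decay (_ : Num.max u 100 = u); last by apply/max_l; lra.
    exact: first_block_error.
  have Ei (i : 'I_N) : E (bump 0 i) <= expR (w - u * ell) * (1 / 2) ^+ i.
    exact: later_block_error.
  have S : \sum_(i < N) E (bump 0 i) <= expR (w - u * ell) * 2.
    apply: (@le_trans _ _ (\sum_(i < N) expR (w - u * ell) * (1 / 2) ^+ i)).
      by apply: ler_sum => i _; exact: Ei.
    by rewrite -mulr_sumr ler_wpM2l ?expR_ge0 // geometric_half_sum.
  have F : expR (w - u * ell) <= expR w * f_decay C u.
    rewrite /f_decay -expRD ler_expR lerD2l -addrA lerDl.
    rewrite (_ : Num.max u 100 = u); last by apply/max_l; lra.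
    apply: addr_ge0; apply: mulr_ge0; [lra| |rewrite /C; lra|lra].
    apply: ln_ge0; apply: le_trans (ltW (ln100_gt1 R)) _.
    by rewrite ler_ln ?posrE //; lra.
  by rewrite /K; move: E0 S F; lra.
exists (brun_hooley R c (fun i : 'I_N.+1 => k i)); split.
- by move=> M; have [] := brun_hooley_norm_support R c (fun i : 'I_N.+1 => k i) M ord0.
- move=> M M0.
  have [_ /(_ M0)[j kj]] := brun_hooley_norm_support R c (fun i : 'I_N.+1 => k i) M ord0.
  apply: le_trans (@block_level R T l N c M L ell k j (ltW L0) _ _ kj) _; [lra| |].
    by move=> t; case/andP: (Hc t).
  rewrite big_ord_recl /=.
  have -> : \sum_(i < N) (n0 + i).*2%:R * (L / (ell * 2 ^+ i)) =
      2 * L / ell * \sum_(i < N) (n0%:R + i%:R) / 2 ^+ i.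
    rewrite mulr_sumr; apply: eq_bigr => i _.
    rewrite -addnn natrD natrD; field.
    by rewrite expf_neq0 //=; lra.
  have S := @arith_geometric_half_sum R n0%:R N (ler0n _ _).
  have S' : 2 * L / ell * \sum_(i < N) (n0%:R + i%:R) / 2 ^+ i <=
      L * ((4 * u + 8) / ell).
    apply: le_trans (_ : 2 * L / ell * (2 * n0%:R + 2) <= _).
      by apply: ler_wpM2l => //; apply: divr_ge0; lra.
    have -> : L * ((4 * u + 8) / ell) = 2 * L / ell * (2 * u + 4) by field; lra.
    by apply: ler_wpM2l; [apply: divr_ge0; lra|lra].
  have -> : k0.*2%:R = 2 * k0%:R :> R by rewrite -addnn natrD; ring.
  have : L * (2 * k0%:R) <= L * (u - 1 - (4 * u + 8) / ell).
    by rewrite ler_pM2l //; lra.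
  by move: S'; rewrite mulrBr mulrBr mulr1 ; lra.
- by move=> Q; exact: brun_hooley_sieve_le ord0.
- have E1 : \sum_(i < N.+1) E i <= 1 by exact: le_trans Etot KC1.
  apply: le_trans (@brun_hooley_main_term R T _ c (fun i : 'I_N.+1 => k i) h
    (fun i : 'I_N.+1 => E i) h01 Emass E1).
  apply: ler_wpM2r; first by apply: prodr_ge0 => t _; have := h01 t; lra.
  by rewrite lerD2l lerN2.
Qed.

(** Only large u need a construction.  For ln u <= m the constant C makes the error term at least 1,
    and whenever the error term is at least 1 the required lower bound is at most 0, which zero
    weights attain.  The sets M play the part of the squarefree integers, with l t = ln t. *)
Theorem fundamental_lemma (R : realType) (kap B : R) :
  0 <= kap -> 0 < B ->
  exists C K : R, 1 <= K /\
  forall (T : finType) (l h : T -> R) (L u : R),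
  0 < L -> 1 <= u -> (forall t, ln 2 <= l t <= L) -> (forall t, 0 <= h t < 1) ->
  sieve_dimension l h kap B L ->
  exists lam : {set T} -> R,
    [/\ forall M, `|lam M| <= 1,
        forall M, lam M != 0 -> \sum_(t in M) l t <= u * L,
        forall Q : {set T}, \sum_(M : {set T} | M \subset Q) lam M <= (Q == finset.set0)%:R
      & (1 - K * f_decay C u) * \prod_t (1 - h t) <=
        \sum_(M : {set T}) lam M * \prod_(t in M) h t].
Proof.
move=> kap0 B0.
have ln2 : 0 < ln (2 : R) by apply: ln_gt0; lra.
set w := kap * ln 2 + B / ln 2.
set C0 := 7 + 2 * kap + 2 * (B / ln 2).
set m := 100 + 2 * w.
pose C := Num.max C0 (m - ln (ln (ln 100))).
pose K := 1 + 2 * expR w.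
have K1 : 1 <= K by rewrite lerDl mulr_ge0 // expR_ge0.
have K0 : 0 < K by lra.
exists C, K; split=> // T l h L u L0 u1 lL h01 dim.
have V0 : 0 <= \prod_t (1 - h t).
  by apply: prodr_ge0 => t _; have := h01 t; lra.
have fC : f_decay C0 u <= f_decay C u.
  by apply: f_decay_mono; [lra|rewrite /C le_max lexx].
have trivial_case : 1 <= K * f_decay C u -> exists lam : {set T} -> R,
    [/\ forall M, `|lam M| <= 1,
        forall M, lam M != 0 -> \sum_(t in M) l t <= u * L,
        forall Q : {set T}, \sum_(M : {set T} | M \subset Q) lam M <= (Q == finset.set0)%:R
      & (1 - K * f_decay C u) * \prod_t (1 - h t) <=
        \sum_(M : {set T}) lam M * \prod_(t in M) h t].
  move=> K1f; exists (fun=> 0); split.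
  - by move=> M; rewrite normr0.
  - by move=> M; rewrite eqxx.
  - by move=> Q; rewrite big1.
  rewrite [leRHS]big1 => [|M _]; last by rewrite mul0r.
  by rewrite mulr_le0_ge0 // subr_le0.
have [um|um] := leP (ln u) m.
  apply: trivial_case; apply: mulr_ege1 => //.
  by apply: f_decay_ge1 u1 um _; rewrite /C le_max lexx orbT.
have [KC|KC] := leP 1 (K * f_decay C0 u).
  by apply: trivial_case; apply: le_trans KC _; rewrite ler_pM2l.
have [lam [H1 H2 H3 H4]] :=
  @lower_sieve_large R kap B T l h L u kap0 B0 (ltW um) L0 lL h01 dim (ltW KC).
exists lam; split => //.
apply: le_trans H4; apply: ler_wpM2r => //.
by rewrite lerD2l lerN2 ler_pM2l.
Qed.

(** * Integers composed of a finite set of primes *)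

Definition all_prime (calP : {fset nat}) : Prop := forall p, p \in calP -> prime p.

Lemma gen_by_gt0 (calP : {fset nat}) d : gen_by calP d -> (0 < d)%N.
Proof. by case/andP. Qed.

Lemma logn_gen_by (calP : {fset nat}) d p :
  gen_by calP d -> p \notin calP -> logn p d = 0%N.
Proof.
move=> /andP[d0 /allP dP] pP; apply/eqP; rewrite -leqn0 leqNgt logn_gt0.
by apply: contra pP => /dP.
Qed.

Lemma eq_gen_by (calP : {fset nat}) d n :
  gen_by calP d -> gen_by calP n ->
  (forall p : calP, logn (val p) d = logn (val p) n) -> d = n.
Proof.
move=> dP nP dn; apply: eqn_from_log; rewrite ?(gen_by_gt0 dP) ?(gen_by_gt0 nP) //.
move=> p; have [pP|pP] := boolP (p \in calP); first exact: dn [` pP]%fset.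
by rewrite (logn_gen_by dP pP) (logn_gen_by nP pP).
Qed.

Lemma dvdn_gen_by (calP : {fset nat}) d n : gen_by calP d -> (0 < n)%N ->
  (d %| n)%N = [forall p : calP, logn (val p) d <= logn (val p) n]%N.
Proof.
move=> dP n0; apply/idP/forallP => [dn p|dn]; first exact: dvdn_leq_log.
apply/dvdn_partP => [|p pd]; first exact: gen_by_gt0 dP.
have pP : p \in calP by case/andP: dP => _ /allP; apply.
have prp : prime p by move: pd; rewrite mem_primes => /andP[].
by rewrite p_part pfactor_dvdn //; exact: (dn [` pP]%fset).
Qed.

Lemma gen_byM (calP : {fset nat}) d n :
  gen_by calP d -> gen_by calP n -> gen_by calP (d * n)%N.
Proof. by rewrite /gen_by pnatM => -> ->. Qed.

Lemma coprime_prime_powers (calP : {fset nat}) (e : calP -> nat) (q : calP) k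
    (r : seq calP) : all_prime calP -> q \notin r ->
  coprime (val q ^ k)%N (\prod_(p <- r) val p ^ e p)%N.
Proof.
move=> prP; elim: r => [|p r IH]; first by rewrite big_nil coprimen1.
rewrite inE negb_or => /andP[qp qr]; rewrite big_cons coprimeMr IH // andbT.
apply: coprimeXl; apply: coprimeXr.
rewrite prime_coprime; last exact: prP (valP q).
by rewrite dvdn_prime2 ?(inj_eq val_inj) //; apply: prP; exact: valP.
Qed.

Lemma gen_by_prod (calP : {fset nat}) (e : calP -> nat) : all_prime calP ->
  gen_by calP (\prod_(p : calP) val p ^ e p)%N.
Proof.
move=> prP; apply: (big_ind (gen_by calP)) => [||p _]; first by [].
  exact: gen_byM.
by rewrite /gen_by pnatX pnatE ?inE ?(valP p) //; apply: prP; exact: valP.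
Qed.

Lemma logn_prod (calP : {fset nat}) (e : calP -> nat) (q : calP) : all_prime calP ->
  logn (val q) (\prod_(p : calP) val p ^ e p)%N = e q.
Proof.
move=> prP; have prq : prime (val q) by apply: prP; exact: valP.
have p0 (p : calP) : (0 < val p ^ e p)%N.
  by rewrite expn_gt0 prime_gt0 //; apply: prP; exact: valP.
rewrite (bigD1 q) // lognM //; last by apply: prodn_cond_gt0 => p _; exact: p0.
rewrite pfactorK // -big_filter [X in (_ + X)%N]logn_coprime ?addn0 //.
rewrite -[X in coprime X]expn1; apply: coprime_prime_powers => //.
by rewrite mem_filter eqxx.
Qed.

Lemma gen_by_factor (calP : {fset nat}) d : all_prime calP -> gen_by calP d ->
  d = (\prod_(p : calP) val p ^ logn (val p) d)%N.
Proof.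
move=> prP dP; apply: (eq_gen_by dP); first exact: gen_by_prod.
by move=> p; rewrite logn_prod.
Qed.

Lemma multiplicative_prod (R : realType) (g : nat -> R) (calP : {fset nat})
    (e : calP -> nat) : all_prime calP -> multiplicative_arith g ->
  g (\prod_(p : calP) val p ^ e p)%N = \prod_(p : calP) g (val p ^ e p)%N.
Proof.
move=> prP [g1 gM]; have p0 (p : calP) : (0 < val p ^ e p)%N.
  by rewrite expn_gt0 prime_gt0 //; apply: prP; exact: valP.
have := index_enum_uniq calP; elim: (index_enum calP) => [|p r IH].
  by rewrite !big_nil g1.
rewrite cons_uniq => /andP[pr ur]; rewrite !big_cons gM ?IH //.
  by apply: prodn_cond_gt0 => q _; exact: p0.
exact: coprime_prime_powers.
Qed.

Lemma multiplicative_gen_by (R : realType) (g : nat -> R) (calP : {fset nat}) d :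
  all_prime calP -> multiplicative_arith g -> gen_by calP d ->
  g d = \prod_(p : calP) g (val p ^ logn (val p) d)%N.
Proof.
by move=> prP gM dP; rewrite {1}(gen_by_factor prP dP) multiplicative_prod.
Qed.

(** Squarefree elements of <P>, indexed by their sets of prime divisors. *)
Definition sqf (calP : {fset nat}) (M : {set calP}) : nat := (\prod_(p in M) val p)%N.

Lemma sqfE (calP : {fset nat}) (M : {set calP}) :
  sqf M = (\prod_(p : calP) val p ^ (p \in M))%N.
Proof. by rewrite /sqf big_mkcond /=; apply: eq_bigr => p _; case: (p \in M). Qed.

Lemma gen_by_sqf (calP : {fset nat}) (M : {set calP}) :
  all_prime calP -> gen_by calP (sqf M).
Proof. by move=> prP; rewrite sqfE; exact: gen_by_prod. Qed.

Lemma logn_mul_sqf (calP : {fset nat}) d (M : {set calP}) (p : calP) :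
  all_prime calP -> (0 < d)%N ->
  logn (val p) (d * sqf M)%N = (logn (val p) d + (p \in M))%N.
Proof.
move=> prP d0; rewrite lognM ?(gen_by_gt0 (gen_by_sqf M prP)) //.
by rewrite sqfE logn_prod.
Qed.

(** The condition d m | n separates into d | n and a condition on the primes dividing m; this is
    what makes the event nu(n) = nu(d) a sieve problem. *)
Lemma dvdn_mul_sqf (calP : {fset nat}) d (M : {set calP}) n :
  all_prime calP -> gen_by calP d -> (0 < n)%N ->
  (d * sqf M %| n)%N =
  (d %| n)%N && (M \subset [set p : calP | logn (val p) d < logn (val p) n]%N%SET).
Proof.
move=> prP dP n0; have d0 := gen_by_gt0 dP.
rewrite (dvdn_gen_by (gen_byM dP (gen_by_sqf M prP)) n0) (dvdn_gen_by dP n0).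
apply/forallP/andP => [H|[/forallP H1 /fintype.subsetP H2] p].
  split; first by apply/forallP => p; have := H p; rewrite logn_mul_sqf //; lia.
  by apply/fintype.subsetP => p pM; have := H p; rewrite logn_mul_sqf // pM inE addn1.
rewrite logn_mul_sqf //; have := H1 p; have [/H2|_ _] := boolP (p \in M).
  by rewrite inE addn1.
by rewrite addn0.
Qed.

Lemma multiplicative_mul_sqf (R : realType) (g : nat -> R) (calP : {fset nat}) d
    (M : {set calP}) : all_prime calP -> multiplicative_arith g ->
  gen_by calP d -> g d != 0 ->
  g (d * sqf M)%N = g d * \prod_(p in M) step_ratio g (val p) d.
Proof.
move=> prP gM dP gd.
have d0 := gen_by_gt0 dP.
have gE := multiplicative_gen_by prP gM dP.
rewrite (multiplicative_gen_by prP gM (gen_byM dP (gen_by_sqf M prP))) gE.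
rewrite (big_mkcond (mem M)) -big_split /=; apply: eq_bigr => p _.
rewrite logn_mul_sqf //; case: ifP => pM; rewrite ?addn0 ?mulr1 // addn1.
rewrite /step_ratio mulrCA divff ?mulr1 //.
by move: gd; rewrite gE => /prodf_neq0; apply.
Qed.

(** The probability that the valuation vector of d is taken by (G_p).  Contrary to [weight] it is
    the right value when g d = 0 as well. *)
Definition local_mass (R : realType) (g : nat -> R) (calP : {fset nat}) d : R :=
  \prod_(p : calP) (g (val p ^ logn (val p) d)%N - g (val p ^ (logn (val p) d).+1)%N).

Lemma weight_local_mass (R : realType) (g : nat -> R) (calP : {fset nat}) d :
  all_prime calP -> multiplicative_arith g -> gen_by calP d -> g d != 0 ->
  weight calP g d = local_mass g calP d.
Proof.
move=> prP gM dP gd; have gE := multiplicative_gen_by prP gM dP.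
rewrite /weight big_seq_fsetE gE -big_split /=; apply: eq_bigr => p _.
rewrite mulrBr mulr1 /step_ratio mulrCA divff ?mulr1 //.
by move: gd; rewrite gE => /prodf_neq0; apply.
Qed.

Lemma local_mass_eq0 (R : realType) (g : nat -> R) (calP : {fset nat}) d :
  all_prime calP -> multiplicative_arith g ->
  (forall n, (0 < n)%N -> 0 <= g n) ->
  (forall p k, p \in calP -> g (p ^ k.+1)%N <= g (p ^ k)%N) ->
  gen_by calP d -> g d = 0 -> local_mass g calP d = 0.
Proof.
move=> prP gM g0 gmono dP /eqP.
rewrite (multiplicative_gen_by prP gM dP) => /prodf_eq0[p _ /eqP gp].
apply/eqP/prodf_eq0; exists p => //; rewrite gp sub0r oppr_eq0 eq_le.
rewrite -{1}gp gmono ?(valP p) //= g0 // expn_gt0 prime_gt0 //.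
by apply: prP; exact: valP.
Qed.

(** A prime p outside P contributes the factor 1, because p * d is then outside <P>. *)
Lemma sieve_dimension_step_ratio (R : realType) (g : nat -> R) (calP : {fset nat})
    (kap B y : R) d : 0 < y ->
  (forall p, p \in calP -> prime p /\ p%:R <= y) ->
  multiplicative_arith g ->
  (forall n, (0 < n)%N -> ~~ gen_by calP n -> g n = 0) ->
  gen_by calP d -> g d != 0 ->
  (forall a b : R, 2 <= a -> a <= b -> b <= y ->
       \prod_(0 <= p < (Num.truncn b).+1 | prime p && (a <= p%:R))
          (1 - g (p * d)%N / g d)^-1
       <= (ln b / ln a) `^ kap * expR (B / ln a)) ->
  sieve_dimension (fun p : calP => ln (val p)%:R)
    (fun p : calP => step_ratio g (val p) d) kap B (ln y).
Proof.
move=> y0 Py gM gsupp dP gd dim al be al2 albe beL.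
have prP : all_prime calP by move=> p /Py[].
have d0 := gen_by_gt0 dP.
have a2 : 2 <= expR al by rewrite -[leLHS]lnK ?posrE // ler_expR.
have bey : expR be <= y by rewrite -[leRHS]lnK // ler_expR.
have := dim (expR al) (expR be) a2; rewrite ler_expR => /(_ albe bey).
rewrite !expRK; apply: le_trans.
pose F p : R := (1 - g (p * d)%N / g d)^-1.
have FE (p : calP) : (1 - step_ratio g (val p) d)^-1 = F (val p).
  rewrite /F mulnC; have := multiplicative_mul_sqf [set p]%SET prP gM dP gd.
  by rewrite /sqf !big_set1 => ->; rewrite mulrAC divff // mul1r.
under eq_bigr => p _ do rewrite FE.
have F1 p : prime p -> p \notin calP -> F p = 1.
  move=> prp pP; rewrite /F gsupp; first by rewrite mul0r subr0 invr1.
    by rewrite muln_gt0 prime_gt0.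
  by rewrite /gen_by pnatM negb_and pnatE ?inE ?pP.
rewrite -(big_seq_fsetE _ calP (fun p => al <= ln p%:R <= be) F) /=.
rewrite [leRHS](bigID (mem calP)) /= [X in _ <= _ * X]big1 ?mulr1; last first.
  by move=> p /andP[/andP[prp _] pP]; exact: F1.
rewrite -big_filter -[leRHS]big_filter le_eqVlt; apply/orP; left; apply/eqP.
apply: perm_big; apply: uniq_perm; rewrite ?filter_uniq ?fset_uniq ?iota_uniq //.
move=> p; rewrite !mem_filter mem_index_iota /=.
have [pP|] := boolP (p \in (calP : seq nat)); last by rewrite !andbF.
have [prp _] := Py p pP.
have p0 : 0 < p%:R :> R by rewrite ltr0n prime_gt0.
rewrite !andbT prp /= -[al <= _]ler_expR -[_ <= be]ler_expR lnK //.
by rewrite ltnS truncn_ge_nat ?expR_ge0.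
Qed.

(** * Sifting the values of the random integer *)

Lemma valuations_eqP (calP : {fset nat}) d n :
  gen_by calP d -> gen_by calP n -> valuations calP d = valuations calP n -> d = n.
Proof.
move=> dP nP /ffunP E; apply: (eq_gen_by dP nP) => p.
by have := E p; rewrite !ffunE.
Qed.

Lemma ffun_valuations (calP : {fset nat}) (e : {ffun calP -> nat}) :
  all_prime calP -> exists2 n, gen_by calP n & e = valuations calP n.
Proof.
move=> prP; exists (\prod_(p : calP) val p ^ e p)%N; first exact: gen_by_prod.
by apply/ffunP => p; rewrite ffunE logn_prod.
Qed.

(** Exchange the sums: an n divisible by d is counted with the weight sum_(M <= Q) lam M, where Q is
    the set of p such that p * d divides n, and this is at most 1 when Q is empty, at most 0
    otherwise. *)
Lemma sieve_counts (R : realType) (calP : {fset nat}) (d N : nat) (a : nat -> R)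
    (lam : {set calP} -> R) :
  all_prime calP -> gen_by calP d -> a 0%N = 0 -> (forall n, 0 <= a n) ->
  (forall Q : {set calP},
     \sum_(M : {set calP} | M \subset Q) lam M <= (Q == finset.set0)%:R) ->
  \sum_(M : {set calP}) lam M * \sum_(0 <= n < N | (d * sqf M %| n)%N) a n
  <= \sum_(0 <= n < N | valuations calP n == valuations calP d) a n.
Proof.
move=> prP dP a00 a0 lamP.
under eq_bigr => M _ do rewrite mulr_sumr big_mkcond /=.
rewrite exchange_big /= [leRHS]big_mkcond /=; apply: ler_sum => n _.
have [->|n0] := posnP n.
  by rewrite a00 big1 => [|M _]; rewrite ?mulr0; case: ifP.
pose Q := [set p : calP | (logn (val p) d < logn (val p) n)%N]%SET.
have -> : \sum_(M : {set calP}) (if (d * sqf M %| n)%N then lam M * a n else 0) =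
   (if (d %| n)%N then \sum_(M : {set calP} | M \subset Q) lam M else 0) * a n.
  case: ifPn => dn.
    rewrite mulr_suml [RHS]big_mkcond /=; apply: eq_bigr => M _.
    by rewrite dvdn_mul_sqf // dn.
  by rewrite mul0r big1 // => M _; rewrite dvdn_mul_sqf // (negPf dn).
case: ifPn => dn; last by rewrite mul0r; case: ifP.
have := lamP Q; have [Q0 h|_ h] := eqVneq Q finset.set0; last first.
  by apply: (@le_trans _ _ 0); [rewrite mulr_le0_ge0|case: ifP].
rewrite ifT; first by rewrite -[leRHS]mul1r ler_wpM2r.
apply/eqP/ffunP => p; rewrite !ffunE; apply/eqP; rewrite eqn_leq.
rewrite (dvdn_leq_log (val p) n0 dn) andbT leqNgt.
by apply/negP => lt; have := finset.in_set0 p; rewrite -Q0 inE lt.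
Qed.

Lemma local_lower_bound (R : realType) (calP : {fset nat}) (g : nat -> R)
    (d N : nat) (a : nat -> R) (lam : {set calP} -> R) (S f : R) :
  all_prime calP -> multiplicative_arith g ->
  gen_by calP d -> a 0%N = 0 -> (forall n, 0 <= a n) -> 0 < g d ->
  (forall M, `|lam M| <= 1) ->
  (forall M, lam M != 0 -> (d * sqf M)%N%:R <= S) ->
  (forall Q : {set calP},
     \sum_(M : {set calP} | M \subset Q) lam M <= (Q == finset.set0)%:R) ->
  (1 - f) * \prod_(p : calP) (1 - step_ratio g (val p) d) <=
    \sum_(M : {set calP}) lam M * \prod_(p in M) step_ratio g (val p) d ->
  local_mass g calP d -
    \sum_(0 <= n < N | valuations calP n == valuations calP d) a n <=
  weight calP g d * f +
  \sum_(M : {set calP} | (d * sqf M)%N%:R <= S)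
     `|\sum_(0 <= n < N | (d * sqf M %| n)%N) a n - g (d * sqf M)%N|.
Proof.
move=> prP gM dP a00 a0 gd lam1 lamS lamP main.
have gd0 : g d != 0 by rewrite gt_eqF.
pose pr m := \sum_(0 <= n < N | (m %| n)%N) a n.
have low := sieve_counts N prP dP a00 a0 lamP.
have WE : weight calP g d = g d * \prod_(p : calP) (1 - step_ratio g (val p) d).
  by rewrite /weight big_seq_fsetE.
have key : weight calP g d * (1 - f) -
    \sum_(M : {set calP} | (d * sqf M)%N%:R <= S) `|pr (d * sqf M)%N - g (d * sqf M)%N|
    <= \sum_(M : {set calP}) lam M * pr (d * sqf M)%N.
  apply: (@le_trans _ _ (\sum_(M : {set calP}) lam M * g (d * sqf M)%N -
     \sum_(M : {set calP} | (d * sqf M)%N%:R <= S)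
       `|pr (d * sqf M)%N - g (d * sqf M)%N|)).
    rewrite lerD2r WE -mulrA [_ * (1 - f)]mulrC.
    apply: le_trans (ler_wpM2l (ltW gd) main) _.
    rewrite mulr_sumr; apply: ler_sum => M _.
    by rewrite multiplicative_mul_sqf // mulrCA.
  rewrite lerBlDl -lerBlDr -sumrB [leRHS]big_mkcond /=; apply: ler_sum => M _.
  rewrite -mulrBr; case: ifPn => dS.
    apply: le_trans (ler_norm _) _; rewrite normrM distrC.
    by rewrite -[leRHS]mul1r ler_wpM2r.
  have [->|l0] := eqVneq (lam M) 0; first by rewrite mul0r.
  by rewrite (lamS _ l0) in dS.
rewrite -(weight_local_mass prP gM dP gd0).
by move: key low; rewrite mulrBr mulr1 /pr; lra.
Qed.

(** The squarefree divisors of m correspond to the subsets of its prime divisors. *)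
Lemma count_sqf_dvdn (calP : {fset nat}) m : all_prime calP -> (0 < m)%N ->
  (\sum_(M : {set calP}) (sqf M %| m)%N <= 2 ^ omega m)%N.
Proof.
move=> prP m0.
pose Q := [set p : calP | (0 < logn (val p) m)%N]%SET.
have -> : (\sum_(M : {set calP}) (sqf M %| m) = #|powerset Q|)%N.
  rewrite -sum1_card [RHS]big_mkcond /=; apply: eq_bigr => M _.
  rewrite -[sqf M]mul1n dvdn_mul_sqf // dvd1n /= inE.
  rewrite (_ : [set p : calP | _]%SET = Q); first by case: (M \subset Q).
  by apply/setP => p; rewrite !inE logn1.
rewrite card_powerset leq_exp2l // /omega cardE -(size_map val).
apply: uniq_leq_size; first by rewrite map_inj_uniq ?enum_uniq //; exact: val_inj.
by move=> x /mapP[p pQ ->]; rewrite -logn_gt0; move: pQ; rewrite mem_enum inE.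
Qed.

Lemma sum_indicator_le1 (R : realType) (n q : nat) (D : pred nat) :
  \sum_(0 <= d < n | D d) (d == q)%:R <= 1 :> R.
Proof.
rewrite big_mkcond /=.
apply: (@le_trans _ _ (\sum_(0 <= d < n) (if d == q then 1 else 0))).
  by apply: ler_sum => d _; case: ifP; case: eqP.
by rewrite -big_mkcond /= big_nat1_eq; case: ifP.
Qed.

(** Collect the pairs (d, M) according to m = d * sqf M.  Given m, the set M is that of a
    squarefree divisor of m, and it determines d. *)
Lemma error_regroup (R : realType) (calP : {fset nat}) (n : nat) (S : R)
    (D : pred nat) (F : nat -> R) :
  all_prime calP -> 0 < S -> (forall m, 0 <= F m) ->
  (forall d, D d -> gen_by calP d) ->
  \sum_(0 <= d < n | D d)
     \sum_(M : {set calP} | (d * sqf M)%N%:R <= S) F (d * sqf M)%N <=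
  \sum_(1 <= m < (Num.truncn S).+1 | gen_by calP m) F m * 2 ^+ omega m.
Proof.
move=> prP S0 F0 DP.
pose I := index_iota 1 (Num.truncn S).+1.
have inner d (M : {set calP}) : D d -> (d * sqf M)%N%:R <= S ->
    F (d * sqf M)%N = \sum_(m <- I | gen_by calP m) (m == d * sqf M)%N%:R * F m.
  move=> Dd dS; have gdM := gen_byM (DP d Dd) (gen_by_sqf M prP).
  rewrite big_mkcond (bigD1_seq (d * sqf M)%N) ?iota_uniq //=; last first.
    rewrite mem_index_iota (gen_by_gt0 gdM) ltnS truncn_ge_nat //.
    exact: ltW.
  rewrite gdM eqxx mul1r big1 ?addr0 // => m /negPf ->.
  by rewrite mul0r; case: ifP.
apply: (@le_trans _ _ (\sum_(0 <= d < n | D d) \sum_(M : {set calP})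
    \sum_(m <- I | gen_by calP m) (m == d * sqf M)%N%:R * F m)).
  apply: ler_sum => d Dd; rewrite [leLHS]big_mkcond; apply: ler_sum => M _ /=.
  case: ifP => dS; first by rewrite (inner d M Dd dS).
  by apply: sumr_ge0 => m _; rewrite mulr_ge0.
under eq_bigr => d _ do rewrite exchange_big /=.
rewrite exchange_big /=; apply: ler_sum => m mP.
have m0 := gen_by_gt0 mP.
rewrite exchange_big /=.
under eq_bigr => M _ do rewrite -mulr_suml.
rewrite -mulr_suml mulrC; apply: ler_wpM2l => //.
rewrite -natrX; apply: le_trans (_ : (\sum_(M : {set calP}) (sqf M %| m)%N)%N%:R <= _).
  rewrite natr_sum; apply: ler_sum => M _.
  have sM := gen_by_gt0 (gen_by_sqf M prP).
  have [/dvdnP[q mE]|nd] := boolP (sqf M %| m)%N; last first.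
    by rewrite big1 // => d _; case: eqP => // mE; rewrite mE dvdn_mull in nd.
  have Eq d : (m == d * sqf M)%N = (d == q).
    by rewrite mE eqn_pmul2r // eq_sym.
  under eq_bigr => d _ do rewrite Eq.
  exact: sum_indicator_le1.
by rewrite ler_nat count_sqf_dvdn.
Qed.

(** Each m has the valuation vector of at most one d in <P>. *)
Lemma sum_fibres_le (R : realType) (calP : {fset nat}) (a : nat -> R) (n N : nat)
    (E : set {ffun calP -> nat}) :
  all_prime calP -> (forall m, 0 <= a m) ->
  \sum_(0 <= d < n | gen_by calP d && (valuations calP d \in E))
    \sum_(0 <= m < N | valuations calP m == valuations calP d) a m
  <= \sum_(0 <= m < N | valuations calP m \in E) a m.
Proof.
move=> prP a0.
under eq_bigr => d _ do rewrite big_mkcond /=.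
rewrite exchange_big /= [leRHS]big_mkcond /=; apply: ler_sum => m _.
have [q qP mq] := ffun_valuations (valuations calP m) prP.
case: ifPn => mE.
  apply: (@le_trans _ _ (\sum_(0 <= d < n | gen_by calP d && (valuations calP d \in E))
      (d == q)%:R * a m)).
    apply: ler_sum => d /andP[dP _]; have [->|dq] := eqVneq d q.
      by rewrite mq eqxx mul1r.
    rewrite mul0r mq; case: eqP => // e; case/eqP: dq.
    exact/esym/(valuations_eqP qP dP).
  rewrite -mulr_suml -[leRHS]mul1r ler_wpM2r //; exact: sum_indicator_le1.
rewrite big1 // => d /andP[_ dE]; case: eqP => // e.
by rewrite -e (negPf mE) in dE.
Qed.

Lemma local_mass_ge0 (R : realType) (g : nat -> R) (calP : {fset nat}) d :
  (forall p k, p \in calP -> g (p ^ k.+1)%N <= g (p ^ k)%N) ->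
  0 <= local_mass g calP d.
Proof.
by move=> gmono; apply: prodr_ge0 => p _; rewrite subr_ge0 gmono //; exact: valP.
Qed.

(** * Laws of valuation vectors and total variation *)

Lemma measurable_nat_rv (d : measure_display) (R : realType)
    (Om : measurableType d) (P : probability Om R) (A : {RV P >-> nat})
    (E : set nat) : measurable (A @^-1` E).
Proof. by rewrite -[X in measurable X]setTI; apply: measurable_funPT. Qed.

Lemma prob_nat_rv_sum (d : measure_display) (R : realType)
    (Om : measurableType d) (P : probability Om R) (A : {RV P >-> nat}) (N : nat)
    (E : pred nat) : (forall w, (A w < N)%N) ->
  fine (P [set w | E (A w)]) =
  \sum_(0 <= n < N | E n) fine (P [set w | A w = n]).
Proof.
move=> AN; pose F n : set Om := if E n then [set w | A w = n] else set0.
have mF n : measurable (F n).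
  by rewrite /F; case: ifP => // _; exact: (measurable_nat_rv A [set n]).
have -> : [set w | E (A w)] = \big[setU/set0]_(n < N) F n.
  rewrite -bigcup_mkord; apply/seteqP; split => w /=.
    by move=> Ew; exists (A w) => //=; rewrite /F Ew.
  by case=> n _; rewrite /F; case: ifPn => // En /= ->.
rewrite measure_semi_additive_ord_I //; last 2 first.
- move=> i j _ _ [w]; rewrite /F; case: ifP => _ [] //=; case: ifP => _ //=.
  by move=> -> ->.
- by apply: bigsetU_measurable.
rewrite -sum_fine => [|i _]; last exact: fin_num_measure.
rewrite [RHS]big_mkcond /= big_mkord; apply: eq_bigr => i _.
by rewrite /F; case: ifP => // _; rewrite measure0.
Qed.

(** Passing to complements exchanges the two laws in the inequality. *)
Lemma dTV_le (R : realType) (d1 d2 : measure_display)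
    (T1 : measurableType d1) (T2 : measurableType d2)
    (P1 : probability T1 R) (P2 : probability T2 R)
    (O : countType) (X : T1 -> O) (Y : T2 -> O) (c : \bar R) :
  (forall E, measurable (X @^-1` E)) -> (forall E, measurable (Y @^-1` E)) ->
  (forall E, (P2 (Y @^-1` E) <= P1 (X @^-1` E) + c)%E) ->
  (dTV P1 P2 X Y <= c)%E.
Proof.
move=> mX mY H; apply: ge_ereal_sup => _ [E _ <-].
have f1 : P1 (X @^-1` E) \is a fin_num by exact: fin_num_measure.
have f2 : P2 (Y @^-1` E) \is a fin_num by exact: fin_num_measure.
have C1 : P1 (X @^-1` (~` E)) = (1 - P1 (X @^-1` E))%E by exact: (probability_setC P1 (mX E)).
have C2 : P2 (Y @^-1` (~` E)) = (1 - P2 (Y @^-1` E))%E by exact: (probability_setC P2 (mY E)).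
have := H (~` E); have := H E.
rewrite C1 C2 -(fineK f1) -(fineK f2); case: c {H} => [c| |].
- rewrite -!EFinB -!EFinD !lee_fin /= => h1 h2.
  by rewrite ler_norml; lra.
- by move=> _ _; exact: leey.
- by move=> + _; rewrite addeNy leeNy_eq.
Qed.

Lemma independent_valuations_mass (R : realType) (d : measure_display)
    (Om : measurableType d) (P : probability Om R) (calP : {fset nat})
    (g : nat -> R) (G : calP -> {RV P >-> nat}) n :
  mutually_independent G ->
  (forall (p : calP) (k : nat),
     P [set w | G p w = k] = (g (val p ^ k)%N - g (val p ^ k.+1)%N)%:E) ->
  P [set w | [ffun p : calP => G p w] = valuations calP n] =
  (local_mass g calP n)%:E.
Proof.
move=> ind law.
have := ind [set: calP]%SET (fun p => [set logn (val p) n]) (fun p => I).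
rewrite (_ : \bigcap_(i in _) _ =
    [set w | [ffun p : calP => G p w] = valuations calP n]); last first.
  apply/seteqP; split => w /=.
    move=> H; apply/ffunP => p; rewrite !ffunE.
    by apply: H; rewrite /= inE.
  by move=> /ffunP H p _ /=; have := H p; rewrite !ffunE.
move=> ->; rewrite /local_mass -prodEFin; apply: eq_big => p; first by rewrite inE.
by move=> _; exact: law.
Qed.

(** The values of Y are the vectors of valuations of the integers of <P>, so its preimages are
    countable disjoint unions of fibres. *)
Lemma valuations_law_series (R : realType) (d : measure_display)
    (Om : measurableType d) (P : probability Om R) (calP : {fset nat})
    (g : nat -> R) (G : calP -> {RV P >-> nat}) (E : set {ffun calP -> nat}) :
  all_prime calP -> mutually_independent G ->
  (forall (p : calP) (k : nat),
     P [set w | G p w = k] = (g (val p ^ k)%N - g (val p ^ k.+1)%N)%:E) ->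
  let Y w := [ffun p : calP => G p w] in
  measurable (Y @^-1` E) /\
  P (Y @^-1` E) = (\sum_(0 <= n <oo | gen_by calP n && (valuations calP n \in E))
    (local_mass g calP n)%:E)%E.
Proof.
move=> prP ind law Y.
pose D : set nat := [set n | gen_by calP n && (valuations calP n \in E)].
pose F n := [set w | Y w = valuations calP n].
have mF n : measurable (F n).
  have -> : F n = \big[setI/setT]_(p <- index_enum calP)
      (G p @^-1` [set logn (val p) n]).
    rewrite -bigcap_seq; apply/seteqP; split => w /=.
      by move=> /ffunP H p _ /=; have := H p; rewrite !ffunE.
    move=> H; apply/ffunP => p; rewrite !ffunE.
    by apply: H; rewrite /= mem_index_enum.
  by apply: bigsetI_measurable => p _; exact: measurable_nat_rv.
have -> : Y @^-1` E = \bigcup_(n in D) F n.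
  apply/seteqP; split => w /=.
    move=> Yw; have [n nP e] := ffun_valuations (Y w) prP.
    by exists n => //=; rewrite /D /= nP -e; exact: mem_set.
  move=> [n /andP[_ /set_mem En] e].
  by rewrite -(e : Y w = valuations calP n) in En.
split; first by apply: bigcup_measurable => n _.
rewrite measure_bigcup => [|n _|]; last 2 first.
- exact: mF.
- move=> i j /andP[iP _] /andP[jP _] [w [e1 e2]].
  by apply: (valuations_eqP iP jP); rewrite -(e1 : Y w = _); exact: e2.
rewrite (eq_eseriesl (Q := fun n => gen_by calP n && (valuations calP n \in E))).
  by apply: eq_eseriesr => n _; exact: independent_valuations_mass.
by move=> n; apply/idP/idP => [/set_mem//|h]; exact: mem_set.
Qed.

(** For the masses m of the valuation vectors in a set, this bounds the part with d > T by the
    series of the weights. *)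
Lemma tail_series_le (R : realType) (w m : nat -> R) (T : R) (D Q : pred nat) :
  0 < T -> (forall d, (0 < d)%N -> Q d -> 0 <= w d) -> (forall d, D d -> 0 <= m d) ->
  (forall d, (0 < d)%N -> D d -> m d != 0 -> Q d && (m d == w d)) ->
  (\sum_((Num.truncn T).+1 <= d <oo | D d) (m d)%:E <=
   \sum_(1 <= d <oo | (T < d%:R)%R && Q d) (w d)%:E)%E.
Proof.
move=> T0 w0 m0 mw.
rewrite [leRHS]eseries_cond.
have c0 d : ((T < d%:R) && Q d) && (0 < d)%N -> (0 <= (w d)%:E)%E.
  by move=> /andP[/andP[_ Qd] d0]; rewrite lee_fin w0.
rewrite [leRHS](nneseries_split_cond 0 (Num.truncn T).+1) // add0n -[leLHS]add0e.
apply: leeD; first by apply: sume_ge0.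
rewrite [leLHS]eseries_cond [leRHS]eseries_cond.
rewrite [leLHS]eseries_mkcond [leRHS]eseries_mkcond; apply: lee_nneseries => d.
  by move=> _ _; case: ifP => // /andP[Dd _]; rewrite lee_fin m0.
move=> _; case: ifPn => [/andP[Dd Td]|_]; last first.
  by case: ifP => // /andP[/c0].
have [m_eq0|mN0] := eqVneq (m d) 0.
  by rewrite m_eq0; case: ifP => // /andP[/c0].
have d0 := leq_ltn_trans (leq0n _) Td.
have /andP[Qd /eqP ->] := mw d d0 Dd mN0.
have Td' : T < d%:R by rewrite -truncn_lt_nat // ltW.
by rewrite Qd Td Td' d0.
Qed.

(** * The comparison theorem *)

Lemma step_ratio_itv (R : realType) (g : nat -> R) (calP : {fset nat}) d :
  all_prime calP -> (forall n, (0 < n)%N -> 0 <= g n) ->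
  (forall p k, p \in calP -> g (p ^ k.+1)%N <= g (p ^ k)%N) ->
  local_mass g calP d != 0 ->
  forall p : calP,
    g (val p ^ (logn (val p) d).+1)%N < g (val p ^ logn (val p) d)%N /\
    0 <= step_ratio g (val p) d < 1.
Proof.
move=> prP g0 gmono /prodf_neq0 nz p.
have lt : g (val p ^ (logn (val p) d).+1)%N < g (val p ^ logn (val p) d)%N.
  rewrite lt_neqAle gmono ?(valP p) // andbT eq_sym -subr_eq0; exact: nz.
have pk0 k : (0 < val p ^ k)%N.
  by rewrite expn_gt0 prime_gt0 //; apply: prP; exact: valP.
have gk := g0 _ (pk0 (logn (val p) d).+1).
split=> //; rewrite /step_ratio ltr_pdivrMr ?mul1r ?lt ?andbT; last exact: le_lt_trans lt.
by rewrite divr_ge0 // g0.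
Qed.

Lemma sqf_expR (R : realType) (calP : {fset nat}) (M : {set calP}) :
  all_prime calP -> (sqf M)%:R = expR (\sum_(p in M) ln (val p)%:R) :> R.
Proof.
move=> prP; rewrite expR_sum /sqf natr_prod; apply: eq_bigr => p _.
by rewrite lnK // posrE ltr0n prime_gt0 //; apply: prP; exact: valP.
Qed.

Lemma step_ratio_ge0 (R : realType) (g : nat -> R) p d : prime p ->
  (forall n, (0 < n)%N -> 0 <= g n) -> 0 <= step_ratio g p d.
Proof.
by move=> prp g0; apply: divr_ge0; apply: g0; rewrite expn_gt0 prime_gt0.
Qed.

Theorem theorem2p3 (R : realType) (kappa B : R) (kappa_ge0 : 0 <= kappa) (B_gt0 : 0 < B) :
  exists C K : R,
  forall (x y : R), 2 <= y -> y <= x ->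
  forall (d1 : measure_display) (Omega1 : measurableType d1)
    (P1 : probability Omega1 R) (A : {RV P1 >-> nat}),
  (forall w, (0 < A w)%N /\ (A w)%:R <= x) ->
  forall calP : {fset nat},
  (forall p, p \in calP -> prime p /\ p%:R <= y) ->
  forall g : nat -> R,
  (forall d, (0 < d)%N -> 0 <= g d <= 1) ->
  multiplicative_arith g ->
  (forall d, (0 < d)%N -> ~~ gen_by calP d -> g d = 0) ->
  (forall p k, p \in calP -> g (p ^ k.+1)%N <= g (p ^ k)%N) ->
  (forall p, p \in calP -> g (p ^ k)%N @[k --> \oo] --> (0 : R)) ->
  (forall d, gen_by calP d ->
     (forall p, p \in calP -> g (p ^ (logn p d).+1)%N < g (p ^ logn p d)%N) ->
     forall a b : R, 2 <= a -> a <= b -> b <= y ->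
       \prod_(0 <= p < (Num.truncn b).+1 | prime p && (a <= p%:R))
          (1 - g (p * d)%N / g d)^-1
       <= (ln b / ln a) `^ kappa * expR (B / ln a)) ->
  forall (d2 : measure_display) (Omega2 : measurableType d2)
    (P2 : probability Omega2 R) (G : calP -> {RV P2 >-> nat}),
  mutually_independent G ->
  (forall (p : calP) (k : nat),
     P2 [set w | G p w = k] = (g (val p ^ k)%N - g (val p ^ k.+1)%N)%:E) ->
  forall S T : R, 0 < T -> T < S -> y <= S / T ->
  (dTV P1 P2 (fun w => valuations calP (A w)) (fun w => [ffun p : calP => G p w])
   <= K%:E * (D1 y S T C calP g + (D2 P1 A S calP g)%:E))%E.
Proof.
have [C [K [K1 FL]]] := fundamental_lemma kappa_ge0 B_gt0.
exists C, K => x y y2 yx d1 Omega1 P1 A Ax calP Py g g01 gM gsupp gmono _ dim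
  d2 Omega2 P2 G Gind Glaw S T T0 TS yST.
have prP : all_prime calP by move=> p /Py[].
have g0 n : (0 < n)%N -> 0 <= g n by move=> /g01 /andP[].
have K0 : 0 <= K by lra.
have S0 : 0 < S by lra.
have y0 : 0 < y by lra.
have ly0 : 0 < ln y by apply: ln_gt0; lra.
set n0 := (Num.truncn T).+1.
pose N := (Num.truncn x).+1.
have AN w : (A w < N)%N.
  rewrite /N ltnS truncn_ge_nat; first by case: (Ax w).
  lra.
pose a n := fine (P1 [set w | A w = n]).
have a0 n : 0 <= a n by apply: fine_ge0.
have a00 : a 0%N = 0.
  rewrite /a (_ : [set w | A w = 0%N] = set0) ?measure0 //.
  by apply/seteqP; split => w //= Aw0; have [] := Ax w; rewrite Aw0.
have prA m : fine (P1 [set w | (m %| A w)%N]) = \sum_(0 <= n < N | (m %| n)%N) a n.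
  exact: (prob_nat_rv_sum (fun n => m %| n)%N AN).
have weight_mass d : gen_by calP d -> g d != 0 ->
    weight calP g d = local_mass g calP d by exact: weight_local_mass.
have gen_neq0 d : (0 < d)%N -> g d != 0 -> gen_by calP d.
  by move=> d0; apply: contraNT => /(gsupp d d0) ->.
have weight_ge0 d : (0 < d)%N -> g d != 0 -> 0 <= weight calP g d.
  move=> d0 gd; rewrite weight_mass //; last exact: gen_neq0.
  exact: local_mass_ge0.
pose Err d := \sum_(M : {set calP} | (d * sqf M)%N%:R <= S)
     `|\sum_(0 <= n < N | (d * sqf M %| n)%N) a n - g (d * sqf M)%N|.
have local d : gen_by calP d -> d%:R <= T ->
    local_mass g calP d -
      \sum_(0 <= n < N | valuations calP n == valuations calP d) a n
    <= (if g d != 0 then weight calP g d * (K * f_decay C (u_ y S d)) else 0) + Err d.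
  move=> dP dT; have d0 := gen_by_gt0 dP.
  have Err0 : 0 <= Err d by apply: sumr_ge0.
  have mu0 : 0 <= \sum_(0 <= n < N | valuations calP n == valuations calP d) a n.
    exact: sumr_ge0.
  have [gd|gd] := eqVneq (g d) 0.
    by rewrite (local_mass_eq0 prP gM g0 gmono dP gd) /=; lra.
  have [m0|m0] := eqVneq (local_mass g calP d) 0.
    by rewrite weight_mass // m0 mul0r /=; lra.
  (* When the mass vanishes there is nothing to bound; otherwise every factor of it is
  positive, which is the condition on d under which products are controlled. *)
  have steps := step_ratio_itv prP g0 gmono m0.
  have dR : 0 < d%:R :> R by rewrite ltr0n.
  have Sd : 0 < S / d%:R by rewrite divr_gt0.
  have u1 : 1 <= u_ y S d.
    rewrite /u_ ler_pdivlMr // mul1r ler_ln ?posrE //.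
    apply: le_trans yST _; rewrite ler_pM2l // lef_pV2 ?posrE //.
  have l_itv (p : calP) : ln (2 : R) <= ln (val p)%:R <= ln y.
    have [prp py] := Py _ (valP p).
    have p2 : 2 <= (val p)%:R :> R by rewrite ler_nat prime_gt1.
    by rewrite !ler_ln ?posrE //; lra.
  have dimd : sieve_dimension (fun p : calP => ln (val p)%:R)
      (fun p : calP => step_ratio g (val p) d) kappa B (ln y).
    apply: sieve_dimension_step_ratio => //; apply: dim => // p pP.
    by have [] := steps [` pP]%fset.
  have [lam [lam1 lamS lamQ main]] := FL calP (fun p : calP => ln (val p)%:R)
    (fun p : calP => step_ratio g (val p) d) (ln y) (u_ y S d) ly0 u1 l_itv
    (fun p => (steps p).2) dimd.
  apply: local_lower_bound main => //.
  - by rewrite lt_neqAle eq_sym gd g0.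
  - move=> M /lamS; rewrite /u_ divfK ?gt_eqF // -ler_expR lnK ?posrE //.
    by rewrite -sqf_expR // natrM ler_pdivlMr // mulrC.
pose W := \sum_(1 <= d < n0 | g d != 0) weight calP g d * f_decay C (u_ y S d).
have D2_ge : \sum_(1 <= m < (Num.truncn S).+1 | gen_by calP m)
     `|\sum_(0 <= n < N | (m %| n)%N) a n - g m| * 2 ^+ omega m <= D2 P1 A S calP g.
  rewrite /D2; apply: ler_sum => m mP; rewrite prA; apply: ler_wpM2l => //.
  rewrite lerDl; case: ifP => // _; rewrite big_seq; apply: prodr_ge0 => p pP.
  by rewrite addr_ge0 // step_ratio_ge0 //; exact: prP.
have W0 : 0 <= W.
  rewrite /W big_nat_cond; apply: sumr_ge0 => d /andP[/andP[d0 _] gd].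
  by rewrite mulr_ge0 ?f_decay_ge0 // weight_ge0.
have D20 : 0 <= D2 P1 A S calP g.
  by apply: le_trans D2_ge; apply: sumr_ge0 => m _; rewrite mulr_ge0 // exprn_ge0.
have finite_part (E : set {ffun calP -> nat}) :
    \sum_(0 <= d < n0 | gen_by calP d && (valuations calP d \in E)) local_mass g calP d
    <= fine (P1 ((fun w => valuations calP (A w)) @^-1` E)) +
       K * (W + D2 P1 A S calP g).
  set D := fun d => gen_by calP d && (valuations calP d \in E).
  have -> : fine (P1 ((fun w => valuations calP (A w)) @^-1` E)) =
      \sum_(0 <= n < N | valuations calP n \in E) a n.
    rewrite -(prob_nat_rv_sum (fun n => valuations calP n \in E) AN).
    congr (fine (P1 _)); apply/seteqP; split => w /=; first exact: mem_set.
    exact: set_mem.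
  have fib := sum_fibres_le n0 N E prP a0.
  have err := error_regroup n0 prP S0
    (fun m => normr_ge0 (\sum_(0 <= n < N | (m %| n)%N) a n - g m))
    (fun d (Dd : D d) => proj1 (elimT andP Dd)).
  have loc : \sum_(0 <= d < n0 | D d) (local_mass g calP d -
      \sum_(0 <= n < N | valuations calP n == valuations calP d) a n) <=
      \sum_(0 <= d < n0 | D d)
        ((if g d != 0 then weight calP g d * (K * f_decay C (u_ y S d)) else 0) + Err d).
    rewrite big_nat_cond [leRHS]big_nat_cond.
    apply: ler_sum => d /andP[/andP[_ dn] /andP[dP _]]; apply: local => //.
    by rewrite -truncn_ge_nat // ltW.
  have WK : \sum_(0 <= d < n0 | D d)
      (if g d != 0 then weight calP g d * (K * f_decay C (u_ y S d)) else 0) <= K * W.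
    rewrite /W mulr_sumr [leRHS]big_mkcond [leLHS]big_mkcond /=.
    have D00 : D 0%N = false by apply/negP => /andP[/gen_by_gt0].
    rewrite [leLHS]big_ltn // D00 add0r.
    rewrite big_nat [leRHS]big_nat; apply: ler_sum => d /andP[d0 _].
    have [gd|gd] := eqVneq (g d) 0; first by case: ifP.
    have p0 : 0 <= weight calP g d * (K * f_decay C (u_ y S d)).
      by rewrite mulr_ge0 ?weight_ge0 // mulr_ge0 // f_decay_ge0.
    by rewrite /= [leRHS]mulrCA; case: ifP.
  (* The errors come with the constant 1, and K is at least 1. *)
  have D2K : D2 P1 A S calP g <= K * D2 P1 A S calP g by rewrite ler_peMl.
  move: loc; rewrite sumrB big_split /= => loc.
  have err' := le_trans err D2_ge.
  rewrite mulrDr; move: loc fib err' WK D2K; rewrite /Err /D; lra.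
have K0e : (0 <= K%:E)%E by rewrite lee_fin.
pose tail := (\sum_(1 <= d <oo | (T < d%:R)%R && (g d != 0%R)) (weight calP g d)%:E)%E.
have tail0 : (0 <= tail)%E.
  by apply: nneseries_ge0 => d d0 /andP[_ gd]; rewrite lee_fin weight_ge0.
apply: dTV_le => E.
- exact: (measurable_nat_rv A (valuations calP @^-1` E)).
- by have [] := valuations_law_series E prP Gind Glaw.
have [_ ->] := valuations_law_series E prP Gind Glaw.
rewrite (nneseries_split_cond 0 n0) => [|d _]; last by rewrite lee_fin local_mass_ge0.
have -> : (K%:E * (D1 y S T C calP g + (D2 P1 A S calP g)%:E) =
    K%:E * tail + (K * (W + D2 P1 A S calP g))%:E)%E.
  rewrite /D1 -/tail -/n0 -/W -addeA -EFinD ge0_muleDr //.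
  by rewrite lee_fin addr_ge0.
rewrite add0n sumEFin.
have f1 : P1 ((fun w => valuations calP (A w)) @^-1` E) \is a fin_num.
  apply: fin_num_measure; exact: (measurable_nat_rv A (valuations calP @^-1` E)).
rewrite -(fineK f1) addeCA [leLHS]addeC; apply: leeD.
  apply: (@le_trans _ _ tail); last first.
    by apply: lee_pemull => //; rewrite lee_fin.
  apply: tail_series_le => //; first by move=> d _; exact: local_mass_ge0.
  move=> d d0 /andP[dP _] m0.
  have gd : g d != 0.
    by apply: contraNneq m0 => gd; apply/eqP; exact: local_mass_eq0.
  by rewrite gd /= weight_mass.
rewrite -EFinD lee_fin; exact: finite_part.
Qed.
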